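(* Every $n$-vertex plane graph $G=(V,E)$ has a vertex set $V'\subseteq V$ with $|V'|\ge n/2$ such that the induced plane graph $G[V']$ is an outerplane graph.
   Context: A plane graph is a planar graph together with a plane embedding, i.e., an equivalence class of planar drawings having the same rotation scheme at every vertex, the same facial cycles for every face, and the same outer face. For $V'\subseteq V$, the induced plane graph $G[V']$ is the subgraph of $G$ induced by $V'$ together with the embedding inherited from $G$ (obtained by deleting from the embedding of $G$ all vertices and edges not in $G[V']$). A plane graph is outerplane if all its vertices are incident to its outer face. *)

(* Defs.v *)
From Stdlib Require Import Reals List.
Open Scope R_scope.

Definition pt : Type := (R * R)%type.

Definition nrm2 (p : pt) : R := fst p * fst p + snd p * snd p.
Definition dist2 (p q : pt) : R :=
  (fst p - fst q) * (fst p - fst q) + (snd p - snd q) * (snd p - snd q).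

Definition cont01 (g : R -> pt) : Prop :=
  forall t, 0 <= t <= 1 -> forall eps, 0 < eps ->
    exists delta, 0 < delta /\
      forall s, 0 <= s <= 1 -> Rabs (s - t) < delta -> dist2 (g s) (g t) < eps.

Definition inj01 (g : R -> pt) : Prop :=
  forall s t, 0 <= s <= 1 -> 0 <= t <= 1 -> g s = g t -> s = t.

Definition simple_graph (n : nat) (E : nat -> nat -> Prop) : Prop :=
  (forall u v, E u v -> E v u) /\
  (forall u, ~ E u u) /\
  (forall u v, E u v -> (u < n)%nat /\ (v < n)%nat).

Record drawing (n : nat) (E : nat -> nat -> Prop) : Type := {
  pos : nat -> pt;
  arc : nat -> nat -> R -> pt;
  pos_inj : forall u v, (u < n)%nat -> (v < n)%nat -> pos u = pos v -> u = v;
  arc_cont : forall u v, E u v -> cont01 (arc u v);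
  arc_inj : forall u v, E u v -> inj01 (arc u v);
  arc_start : forall u v, E u v -> arc u v 0 = pos u;
  arc_end : forall u v, E u v -> arc u v 1 = pos v;
  arc_sym : forall u v t, E u v -> arc v u t = arc u v (1 - t);
  arc_avoid_vertices : forall u v w t, E u v -> (w < n)%nat -> 0 < t < 1 ->
     arc u v t <> pos w;
  arc_noncrossing : forall u v u' v' t s, E u v -> E u' v' ->
     ~ ((u = u' /\ v = v') \/ (u = v' /\ v = u')) ->
     0 < t < 1 -> 0 < s < 1 -> arc u v t <> arc u' v' s
}.

Arguments pos {n E} d _.
Arguments arc {n E} d _ _ _.

Definition on_drawing {n E} (D : drawing n E) (S : nat -> Prop) (p : pt) : Prop :=
  (exists w, (w < n)%nat /\ S w /\ p = pos D w) \/
  (exists u v t, E u v /\ S u /\ S v /\ 0 <= t <= 1 /\ p = arc D u v t).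

Definition in_outer_face {n E} (D : drawing n E) (S : nat -> Prop) (q : pt) : Prop :=
  exists g : R -> pt, cont01 g /\ g 0 = q /\
    (forall t, 0 <= t <= 1 -> ~ on_drawing D S (g t)) /\
    (forall p, on_drawing D S p -> nrm2 p < nrm2 (g 1)).

Definition incident_outer {n E} (D : drawing n E) (S : nat -> Prop) (v : nat) : Prop :=
  forall eps, 0 < eps -> exists q, dist2 q (pos D v) < eps /\ in_outer_face D S q.

Definition induced_outerplane {n E} (D : drawing n E) (S : nat -> Prop) : Prop :=
  forall v, (v < n)%nat -> S v -> incident_outer D S v.

(* Main.v *)
Require Import Defs.
From Stdlib Require Import Reals List Lra Lia Classical ClassicalEpsilon Bool Arith ZArith Btauto.
Import Defs ListNotations.

(* Call two vertices cofacial if some face of the drawing touches both. The cofaciality graph is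
   connected and the neighbourhood of each of its vertices is connected, so its vertices can be
   ordered such that each new one is adjacent to two adjacent earlier ones. By induction along such an
   order there is a connected dominating set with at most [n/2 - 1] vertices if [n >= 4], hence one with
   at most [n/2] vertices that contains a vertex [a] of the outer face. Delete it: removing a vertex merges
   the faces around it, so every deleted vertex ends up in the outer face, and every remaining vertex
   is cofacial with a deleted one.

   The topological input is that a face touching an interior point of an edge touches both its ends.
   It follows from a case of Janiszewski's theorem, proved by Alexander's mod 2 argument on a grid. *)

(** * Compact sets and polygonal connection *)

(** Edges are arbitrary continuous arcs and the graph may be disconnected, so neither a rotation at
    a vertex nor a facial cycle is at hand. A face is therefore represented by one of its points and
    incidence by closure ([touches]). Statements about faces are proved by colouring points of the
    plane and checking that the colour is locally constant. Near a vertex or an interior point of an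
    edge, this check asks that every face coming close touches the ends concerned, which is why that
    fact is the main topological input.

    In the combinatorial part, a vertex [v] attached to the edge [a b] is dominated as soon as the
    chosen set contains [a] or [b]. Removing [v] thus leaves behind the demand that [a b] be
    covered, and the induction has to carry a list [F] of such edges. A demand weighs as much as a
    vertex: the bound is half of [length l + length F], minus one. The spare one pays for the vertex
    of the outer face. *)

Definition dinf (p q : pt) : R := Rmax (Rabs (fst p - fst q)) (Rabs (snd p - snd q)).

(** Squares instead of discs: distance conditions become linear and fall to [lra], and the squares
    match the cells of a grid. *)
Lemma dinf_lt p q r :
  dinf p q < r <-> - r < fst p - fst q < r /\ - r < snd p - snd q < r.
Proof.
  unfold dinf; split.
  - intros H.
    pose proof (Rmax_l (Rabs (fst p - fst q)) (Rabs (snd p - snd q))).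
    pose proof (Rmax_r (Rabs (fst p - fst q)) (Rabs (snd p - snd q))).
    split; apply and_comm, Rabs_def2; lra.
  - intros [H1 H2]. apply Rmax_lub_lt; apply Rabs_def1; lra.
Qed.

Lemma dinf_le p q r :
  dinf p q <= r <-> - r <= fst p - fst q <= r /\ - r <= snd p - snd q <= r.
Proof.
  unfold dinf; split.
  - intros H.
    pose proof (Rmax_l (Rabs (fst p - fst q)) (Rabs (snd p - snd q))).
    pose proof (Rmax_r (Rabs (fst p - fst q)) (Rabs (snd p - snd q))).
    assert (H3 : Rabs (fst p - fst q) <= r) by lra.
    assert (H4 : Rabs (snd p - snd q) <= r) by lra.
    revert H3 H4; unfold Rabs; repeat destruct Rcase_abs; lra.
  - intros [H1 H2]. apply Rmax_lub; apply Rabs_le; lra.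
Qed.

Lemma dinf_sym p q : dinf p q = dinf q p.
Proof. unfold dinf. now rewrite (Rabs_minus_sym (fst p)), (Rabs_minus_sym (snd p)). Qed.

Lemma dinf_pos p q : 0 <= dinf p q.
Proof. unfold dinf. eapply Rle_trans; [apply Rabs_pos | apply Rmax_l]. Qed.

Lemma dinf_refl p : dinf p p = 0.
Proof.
  apply Rle_antisym; [apply dinf_le; lra | apply dinf_pos].
Qed.

Lemma dinf_tri p q s : dinf p s <= dinf p q + dinf q s.
Proof.
  pose proof (proj1 (dinf_le p q _) (Rle_refl _)).
  pose proof (proj1 (dinf_le q s _) (Rle_refl _)).
  apply dinf_le; lra.
Qed.

Lemma dinf_sep p q : p <> q -> 0 < dinf p q.
Proof.
  intros H. destruct (dinf_pos p q) as [L | L]; [exact L | exfalso; apply H].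
  pose proof (proj1 (dinf_le p q 0) ltac:(lra)).
  destruct p, q; simpl in *; f_equal; lra.
Qed.

Lemma dist2_of_dinf p q r : dinf p q < r -> dist2 p q < 2 * (r * r).
Proof.
  intros H%dinf_lt. unfold dist2.
  assert (forall x, - r < x < r -> x * x < r * r) by (intros; nra).
  pose proof (H0 (fst p - fst q)). pose proof (H0 (snd p - snd q)). lra.
Qed.

Lemma dinf_of_dist2 p q r : 0 < r -> dist2 p q < r * r -> dinf p q < r.
Proof.
  unfold dist2; intros Hr H. apply dinf_lt.
  pose proof (Rle_0_sqr (fst p - fst q)). pose proof (Rle_0_sqr (snd p - snd q)).
  unfold Rsqr in *. split; split; nra.
Qed.

Lemma cont01_dinf g t r : cont01 g -> 0 <= t <= 1 -> 0 < r ->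
  exists delta, 0 < delta /\
    forall s, 0 <= s <= 1 -> Rabs (s - t) < delta -> dinf (g s) (g t) < r.
Proof.
  intros Hg Ht Hr. destruct (Hg t Ht (r * r)) as [e [He H]]; [nra |].
  exists e; split; [exact He | intros s Hs Hst; apply dinf_of_dist2; auto].
Qed.

(** Connectedness of the interval: [P] spreads to both sides of every point, so the supremum of the
    points with [P] cannot lie below 1, and [P] holds there. *)
Lemma unit_interval_induction (P : R -> Prop) :
  (forall t, 0 <= t <= 1 -> exists e, 0 < e /\ forall s s', 0 <= s <= 1 -> 0 <= s' <= 1 ->
     Rabs (s - t) < e -> Rabs (s' - t) < e -> P s -> P s') ->
  P 0 -> P 1.
Proof.
  intros HP H0.
  destruct (completeness (fun s => 0 <= s <= 1 /\ P s)) as [t [Hub Hlub]].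
  { exists 1. intros s Hs; lra. }
  { exists 0; split; [lra | exact H0]. }
  assert (Ht0 : 0 <= t) by (apply Hub; split; [lra | exact H0]).
  assert (Ht1 : t <= 1) by (apply Hlub; intros s Hs; lra).
  destruct (HP t (conj Ht0 Ht1)) as [e [He HPt]].
  destruct (classic (exists s, t - e < s /\ 0 <= s <= 1 /\ P s)) as [[s [Hs1 [Hs2 Hs3]]] | N].
  - assert (Hst : s <= t) by (apply Hub; split; assumption).
    assert (HP' : P (Rmin 1 (t + e / 2))).
    { apply (HPt s); auto.
      - unfold Rmin; destruct Rle_dec; lra.
      - apply Rabs_def1; lra.
      - unfold Rmin; destruct Rle_dec; apply Rabs_def1; lra. }
    assert (Rmin 1 (t + e / 2) <= t).
    { apply Hub; split; [unfold Rmin; destruct Rle_dec; lra | exact HP']. }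
    revert HP' H. unfold Rmin; destruct Rle_dec; intros; [assumption | lra].
  - exfalso. assert (t <= t - e); [| lra].
    apply Hlub. intros s Hs. apply Rnot_lt_le; intros L. apply N; exists s; tauto.
Qed.

(** [good c r] is read as a property of the square of radius [r] around [c] which every square
    inside it inherits. *)
Definition shrinking (good : pt -> R -> Prop) : Prop :=
  forall c c' r r', good c r -> dinf c c' + r' <= r -> good c' r'.

(* Compactness in the form of the Lebesgue number lemma. *)
Definition cpt (K : pt -> Prop) : Prop :=
  forall good, shrinking good -> (forall k, K k -> exists r, 0 < r /\ good k r) ->
    exists r, 0 < r /\ forall k, K k -> good k r.

Lemma good_le good c r r' : shrinking good -> good c r -> r' <= r -> good c r'.
Proof. intros S G L. apply (S c c r r'); [exact G | rewrite dinf_refl; lra]. Qed.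

Lemma cpt_empty (K : pt -> Prop) : (forall p, ~ K p) -> cpt K.
Proof. intros H good _ _. exists 1; split; [lra | intros k Hk; destruct (H k Hk)]. Qed.

Lemma cpt_union K L : cpt K -> cpt L -> cpt (fun p => K p \/ L p).
Proof.
  intros HK HL good S G.
  destruct (HK good S) as [r [Hr Gr]]; [auto |].
  destruct (HL good S) as [s [Hs Gs]]; [auto |].
  exists (Rmin r s); split; [apply Rmin_glb_lt; lra |].
  intros k [Hk | Hk]; [apply (good_le good k r) | apply (good_le good k s)]; auto;
    [apply Rmin_l | apply Rmin_r].
Qed.

Lemma cpt_ext K L : (forall p, K p <-> L p) -> cpt K -> cpt L.
Proof.
  intros E HK good S G. destruct (HK good S) as [r [Hr Gr]].
  - intros k Hk; apply G, E, Hk.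
  - exists r; split; [exact Hr | intros k Hk; apply Gr, E, Hk].
Qed.

Lemma cpt_bunion (n : nat) (K : nat -> pt -> Prop) :
  (forall i, cpt (K i)) -> cpt (fun p => exists i, (i < n)%nat /\ K i p).
Proof.
  intros H. induction n as [| n IH].
  - apply cpt_empty. intros p [i [Hi _]]; lia.
  - apply (cpt_ext (fun p => (exists i, (i < n)%nat /\ K i p) \/ K n p));
      [| apply cpt_union; auto].
    intros p; split.
    + intros [[i [Hi Hp]] | Hp]; [exists i; split; [lia | exact Hp] | exists n; auto].
    + intros [i [Hi Hp]]. destruct (Nat.eq_dec i n) as [-> | N]; [auto |].
      left; exists i; split; [lia | exact Hp].
Qed.

Lemma cpt_guard (Q : Prop) K : (Q -> cpt K) -> cpt (fun p => Q /\ K p).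
Proof.
  intros H. destruct (classic Q) as [HQ | HQ].
  - apply (cpt_ext K); [tauto | auto].
  - apply cpt_empty; tauto.
Qed.

Lemma cpt_point c : cpt (fun p => p = c).
Proof.
  intros good S G. destruct (G c eq_refl) as [r [Hr Gr]].
  exists r; split; [exact Hr | intros k ->; exact Gr].
Qed.

(** Heine-Borel by interval induction: the property carried along is that one radius serves all
    parameters up to [s]. *)
Lemma cpt_arc01 g : cont01 g -> cpt (fun p => exists t, 0 <= t <= 1 /\ p = g t).
Proof.
  intros Hg good S G.
  assert (H : exists r, 0 < r /\ forall u, 0 <= u <= 1 -> good (g u) r).
  { apply (fun A B => unit_interval_induction
      (fun s => exists r, 0 < r /\ forall u, 0 <= u <= s -> good (g u) r) A B).
    - intros t Ht. destruct (G (g t)) as [r [Hr Gr]]; [exists t; auto |].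
      destruct (cont01_dinf g t (r / 2) Hg Ht) as [e [He Hc]]; [lra |].
      exists e; split; [exact He |]. intros s s' Hs Hs' Hst Hst' [r1 [Hr1 G1]].
      exists (Rmin r1 (r / 2)); split; [apply Rmin_glb_lt; lra |].
      intros u Hu. destruct (Rle_dec u s) as [L | L].
      + apply (good_le good _ r1); auto; [apply G1; lra | apply Rmin_l].
      + apply (S (g t) _ r _ Gr). pose proof (Rmin_r r1 (r / 2)).
        apply Rabs_def2 in Hst; apply Rabs_def2 in Hst'.
        specialize (Hc u ltac:(lra) ltac:(apply Rabs_def1; lra)).
        rewrite dinf_sym; lra.
    - destruct (G (g 0)) as [r [Hr Gr]]; [exists 0; split; [lra | auto] |].
      exists r; split; [exact Hr |]. intros u Hu. now replace u with 0 by lra. }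
  destruct H as [r [Hr H]]. exists r; split; [exact Hr | intros k [t [Ht ->]]; auto].
Qed.

Lemma cpt_subarc g a b : cont01 g -> 0 <= a -> a <= b -> b <= 1 ->
  cpt (fun p => exists t, a <= t <= b /\ p = g t).
Proof.
  intros Hg H0 Hab H1.
  apply (cpt_ext (fun p => exists t, 0 <= t <= 1 /\ p = g (a + t * (b - a)))).
  - intros p; split; intros [t [Ht ->]].
    + exists (a + t * (b - a)); split; [nra | reflexivity].
    + destruct (Req_dec a b) as [E | N].
      * exists 0; split; [lra |]. f_equal; lra.
      * exists ((t - a) / (b - a)); split; [split |].
        -- apply Rmult_le_reg_r with (b - a); [lra |]. field_simplify; lra.
        -- apply Rmult_le_reg_r with (b - a); [lra |]. field_simplify; lra.
        -- f_equal. field; lra.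
  - apply (cpt_arc01 (fun t => g (a + t * (b - a)))). intros t Ht eps He.
    destruct (Hg (a + t * (b - a)) ltac:(nra) eps He) as [e [Hpe H]].
    exists e; split; [exact Hpe |]. intros s Hs Hst. apply H; [nra |].
    replace (a + s * (b - a) - (a + t * (b - a))) with ((s - t) * (b - a)) by ring.
    rewrite Rabs_mult. rewrite (Rabs_right (b - a)) by lra.
    pose proof (Rabs_pos (s - t)). nra.
Qed.

Lemma cpt_closed K p : cpt K -> ~ K p ->
  exists r, 0 < r /\ forall q, dinf q p < r -> ~ K q.
Proof.
  intros HK Hp.
  destruct (HK (fun c r => r <= dinf c p)) as [r [Hr H]].
  - intros c c' r r' H1 H2. pose proof (dinf_tri c c' p). lra.
  - intros k Hk. exists (dinf k p); split; [| lra].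
    apply dinf_sep. intros ->; auto.
  - exists r; split; [exact Hr |]. intros q Hq Kq. specialize (H q Kq). simpl in H. lra.
Qed.

Lemma cpt_bounded K : cpt K -> exists M, 0 < M /\ forall k, K k -> dinf k (0, 0) < M.
Proof.
  intros HK.
  (* For positive [r], [good] says that [r] is at most the reciprocal of a number exceeding the norm
     on the whole square, so a uniform [r] bounds the norm by [/ r]. The case [r <= 0] makes the
     property hereditary. *)
  destruct (HK (fun c r => r * (dinf c (0, 0) + r + 1) <= 1 \/ r <= 0)) as [r [Hr H]].
  - intros c c' r r' [H1 | H1] H2; pose proof (dinf_pos c c'); pose proof (dinf_tri c' c (0, 0));
      rewrite (dinf_sym c' c) in *; pose proof (dinf_pos c' (0, 0)); [| right; lra].
    destruct (Rle_dec r' 0); [right; assumption | left]. nra.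
  - intros k _. pose proof (dinf_pos k (0, 0)).
    exists (/ (dinf k (0, 0) + 2)); assert (0 < / (dinf k (0, 0) + 2)) by (apply Rinv_0_lt_compat; lra).
    split; [assumption |]. left.
    assert (/ (dinf k (0, 0) + 2) * (dinf k (0, 0) + 2) = 1) by (field; lra). nra.
  - exists (/ r); split; [apply Rinv_0_lt_compat; lra |]. intros k Hk.
    destruct (H k Hk) as [L | L]; [| lra].
    apply Rmult_lt_reg_l with r; [lra |]. rewrite Rinv_r by lra. nra.
Qed.

Definition seg (p q : pt) (t : R) : pt :=
  (fst p + t * (fst q - fst p), snd p + t * (snd q - snd p)).

Definition seg_off (K : pt -> Prop) (p q : pt) : Prop := forall t, 0 <= t <= 1 -> ~ K (seg p q t).

(* Connection by a polygonal line in the complement of [K]. *)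
Inductive conn (K : pt -> Prop) : pt -> pt -> Prop :=
| conn_refl p : ~ K p -> conn K p p
| conn_snoc p q s : conn K p q -> seg_off K q s -> conn K p s.

Lemma seg_0 p q : seg p q 0 = p.
Proof. destruct p; unfold seg; simpl; f_equal; ring. Qed.

Lemma seg_1 p q : seg p q 1 = q.
Proof. destruct q; unfold seg; simpl; f_equal; ring. Qed.

Lemma seg_rev p q t : seg q p t = seg p q (1 - t).
Proof. unfold seg; f_equal; ring. Qed.

Lemma seg_off_sym K p q : seg_off K p q -> seg_off K q p.
Proof. intros H t Ht. rewrite seg_rev. apply H; lra. Qed.

Lemma dinf_seg p q s t : dinf (seg p q s) (seg p q t) = Rabs (s - t) * dinf p q.
Proof.
  unfold dinf, seg; simpl. rewrite <- RmaxRmult by apply Rabs_pos.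
  rewrite <- !Rabs_mult.
  f_equal; rewrite <- Rabs_Ropp; f_equal; ring.
Qed.

Lemma seg_off_incl (K L : pt -> Prop) p q : (forall u, K u -> L u) -> seg_off L p q -> seg_off K p q.
Proof. intros H S t Ht Hk. exact (S t Ht (H _ Hk)). Qed.

Lemma conn_incl (K L : pt -> Prop) p q : (forall u, K u -> L u) -> conn L p q -> conn K p q.
Proof.
  intros H C. induction C as [p Hp | p q s C IH S].
  - apply conn_refl; auto.
  - apply conn_snoc with q; [exact IH | exact (seg_off_incl K L q s H S)].
Qed.

Lemma conn_right K p q : conn K p q -> ~ K q.
Proof.
  intros [p' Hp | p' q' s _ S]; [exact Hp |].
  specialize (S 1 ltac:(lra)). now rewrite seg_1 in S.
Qed.

Lemma conn_seg K p q : seg_off K p q -> conn K p q.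
Proof.
  intros S. apply conn_snoc with p; [| exact S].
  apply conn_refl. specialize (S 0 ltac:(lra)). now rewrite seg_0 in S.
Qed.

Lemma conn_trans K p q s : conn K p q -> conn K q s -> conn K p s.
Proof.
  intros C1 C2. induction C2 as [q Hq | q u s C2 IH S]; [exact C1 |].
  apply conn_snoc with u; auto.
Qed.

Lemma conn_sym K p q : conn K p q -> conn K q p.
Proof.
  intros C. induction C as [p Hp | p q s C IH S]; [apply conn_refl; exact Hp |].
  apply conn_trans with q; [apply conn_seg, seg_off_sym, S | exact IH].
Qed.

Lemma conn_left K p q : conn K p q -> ~ K p.
Proof. intros C; apply (conn_right K q p), conn_sym, C. Qed.

Lemma dinf_seg_ball c r p q t : 0 <= t <= 1 -> dinf p c < r -> dinf q c < r -> dinf (seg p q t) c < r.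
Proof.
  intros Ht Hp%dinf_lt Hq%dinf_lt.
  assert (C : forall a b m, - r < a - m < r -> - r < b - m < r -> - r < a + t * (b - a) - m < r).
  { intros a b m Ha Hb. destruct (Rle_dec t (1/2)); split; nra. }
  apply dinf_lt; unfold seg; simpl; split; apply C; lra.
Qed.

Lemma conn_ball (K : pt -> Prop) c r p q : (forall u, dinf u c < r -> ~ K u) ->
  dinf p c < r -> dinf q c < r -> conn K p q.
Proof.
  intros H Hp Hq. apply conn_seg. intros t Ht. apply H, dinf_seg_ball; assumption.
Qed.

Lemma seg_near p q t r : 0 < r -> exists e, 0 < e /\
  forall s, Rabs (s - t) < e -> dinf (seg p q s) (seg p q t) < r.
Proof.
  intros Hr. pose proof (dinf_pos p q).
  assert (0 < / (dinf p q + 1)) by (apply Rinv_0_lt_compat; lra).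
  exists (r * / (dinf p q + 1)); split; [nra |].
  intros s Hs. rewrite dinf_seg.
  assert (E : r = r * / (dinf p q + 1) * (dinf p q + 1)) by (field; lra).
  pose proof (Rabs_pos (s - t)).
  apply Rle_lt_trans with (Rabs (s - t) * (dinf p q + 1)); nra.
Qed.

Lemma seg_cont01 p q : cont01 (seg p q).
Proof.
  intros t _ eps He.
  assert (0 < Rmin 1 (eps / 2)) by (apply Rmin_glb_lt; lra).
  destruct (seg_near p q t (Rmin 1 (eps / 2)) H) as [e [Hpe Hn]].
  exists e; split; [exact Hpe |]. intros s _ Hs.
  specialize (Hn s Hs). apply dist2_of_dinf in Hn.
  pose proof (Rmin_l 1 (eps / 2)). pose proof (Rmin_r 1 (eps / 2)). nra.
Qed.

(** A property that is locally constant off [K] is constant on each component of the complement. All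
    colouring arguments are run through this form. *)
Lemma conn_induction (K Q : pt -> Prop) p q :
  (forall w, ~ K w -> exists r, 0 < r /\ forall u u', dinf u w < r -> dinf u' w < r ->
     ~ K u -> ~ K u' -> Q u -> Q u') ->
  conn K p q -> Q p -> Q q.
Proof.
  intros H C. induction C as [p Hp | p q s C IH S]; [auto |]. intros Hp. specialize (IH Hp).
  rewrite <- (seg_1 q s). rewrite <- (seg_0 q s) in IH.
  revert IH. apply (unit_interval_induction (fun t => Q (seg q s t))). intros t Ht.
  destruct (H (seg q s t) (S t Ht)) as [r [Hr Hloc]].
  destruct (seg_near q s t r Hr) as [e [He Hn]].
  exists e; split; [exact He |]. intros u u' Hu Hu' Hut Hut'.
  apply Hloc; auto.
Qed.

Lemma conn_path (K : pt -> Prop) g : cpt K -> cont01 g ->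
  (forall t, 0 <= t <= 1 -> ~ K (g t)) -> conn K (g 0) (g 1).
Proof.
  intros HK Hg Hoff.
  apply (fun A B => unit_interval_induction (fun s => conn K (g 0) (g s)) A B);
    [| apply conn_refl, Hoff; lra].
  intros t Ht. destruct (cpt_closed K (g t) HK (Hoff t Ht)) as [r [Hr Hb]].
  destruct (cont01_dinf g t r Hg Ht Hr) as [e [He Hc]].
  exists e; split; [exact He |]. intros s s' Hs Hs' Hst Hst' C.
  apply conn_trans with (g s); [exact C |]. apply (conn_ball K (g t) r); auto.
Qed.

(** The bridge to [in_outer_face], which speaks of continuous paths. Elsewhere polygonal lines are
    preferred because they admit induction on their segments. *)
Lemma path_of_conn K p q : conn K p q ->
  exists g, cont01 g /\ g 0 = p /\ g 1 = q /\ forall t, 0 <= t <= 1 -> ~ K (g t).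
Proof.
  intros C. induction C as [p Hp | p q s C [g [Hg [G0 [G1 Goff]]]] S].
  - exists (fun _ => p); repeat split; auto.
    intros t Ht eps He; exists 1; split; [lra |]. intros. unfold dist2. lra.
  - exists (fun t => if Rle_dec t (1/2) then g (2 * t) else seg q s (2 * t - 1)).
    assert (J : g (2 * (1/2)) = seg q s (2 * (1/2) - 1)).
    { replace (2 * (1/2)) with 1 by lra. rewrite G1.
      replace (1 - 1) with 0 by lra. now rewrite seg_0. }
    repeat split.
    + intros t Ht eps He.
      assert (L : t <= 1/2 -> exists e, 0 < e /\ forall u, 0 <= u <= 1/2 -> Rabs (u - t) < e ->
        dist2 (g (2 * u)) (g (2 * t)) < eps).
      { intros L. destruct (Hg (2 * t) ltac:(lra) eps He) as [e [Hpe H]].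
        exists (e / 2); split; [lra |]. intros u Hu Hut. apply H; [lra |].
        apply Rabs_def2 in Hut. apply Rabs_def1; lra. }
      assert (R' : 1/2 <= t -> exists e, 0 < e /\ forall u, 1/2 <= u <= 1 -> Rabs (u - t) < e ->
        dist2 (seg q s (2 * u - 1)) (seg q s (2 * t - 1)) < eps).
      { intros L'. destruct (seg_cont01 q s (2 * t - 1) ltac:(lra) eps He) as [e [Hpe H]].
        exists (e / 2); split; [lra |]. intros u Hu Hut. apply H; [lra |].
        apply Rabs_def2 in Hut. apply Rabs_def1; lra. }
      destruct (Rlt_le_dec t (1/2)) as [T | T]; [| destruct (Req_dec t (1/2)) as [T' | T']].
      * destruct (L ltac:(lra)) as [e [Hpe H]].
        exists (Rmin e (1/2 - t)); split; [apply Rmin_glb_lt; lra |].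
        intros u Hu Hut. pose proof (Rmin_l e (1/2 - t)). pose proof (Rmin_r e (1/2 - t)).
        assert (u <= 1/2) by (apply Rabs_def2 in Hut; lra).
        do 2 (destruct Rle_dec; [| lra]). apply H; lra.
      * destruct (L ltac:(lra)) as [e [Hpe H]]. destruct (R' ltac:(lra)) as [e' [Hpe' H']].
        exists (Rmin e e'); split; [apply Rmin_glb_lt; lra |].
        intros u Hu Hut. pose proof (Rmin_l e e'). pose proof (Rmin_r e e').
        destruct (Rle_dec t (1/2)); [| lra].
        destruct (Rle_dec u (1/2)); [apply H; lra |].
        rewrite T', J, <- T'. apply H'; lra.
      * destruct (R' ltac:(lra)) as [e [Hpe H]].
        exists (Rmin e (t - 1/2)); split; [apply Rmin_glb_lt; lra |].
        intros u Hu Hut. pose proof (Rmin_l e (t - 1/2)). pose proof (Rmin_r e (t - 1/2)).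
        assert (1/2 < u) by (apply Rabs_def2 in Hut; lra).
        do 2 (destruct Rle_dec; [lra |]). apply H; lra.
    + destruct Rle_dec; [| lra]. now rewrite Rmult_0_r.
    + destruct Rle_dec; [lra |]. replace (2 * 1 - 1) with 1 by lra. apply seg_1.
    + intros t Ht. destruct Rle_dec; [apply Goff | apply S]; lra.
Qed.

Definition thick (K : pt -> Prop) (r : R) (p : pt) : Prop := exists k, K k /\ dinf p k < r.

Lemma thick_incl (K : pt -> Prop) r p : 0 < r -> K p -> thick K r p.
Proof. intros Hr Hp; exists p; split; [exact Hp | now rewrite dinf_refl]. Qed.

Lemma thick_mono (K : pt -> Prop) r r' p : r <= r' -> thick K r p -> thick K r' p.
Proof. intros L [k [Hk H]]; exists k; split; [exact Hk | lra]. Qed.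

(** A polygonal line off a compact set keeps a positive distance from it; this is the room in which
    it can be rounded to a grid. *)
Lemma conn_thick K p q : cpt K -> conn K p q -> exists r, 0 < r /\ conn (thick K r) p q.
Proof.
  intros HK C. induction C as [p Hp | p q s C [r [Hr IH]] S].
  - destruct (cpt_closed K p HK Hp) as [r [Hr H]]. exists r; split; [exact Hr |].
    apply conn_refl. intros [k [Hk Hd]]. rewrite dinf_sym in Hd. exact (H k Hd Hk).
  - destruct (cpt_arc01 _ (seg_cont01 q s) (fun c r => forall u, dinf u c < r -> ~ K u)) as [r' [Hr' H]].
    + intros c c' r1 r1' H1 H2 u Hu. apply H1.
      pose proof (dinf_tri u c' c). rewrite (dinf_sym c' c) in *. lra.
    + intros k [t [Ht ->]]. apply cpt_closed; auto.
    + exists (Rmin r r'); split; [apply Rmin_glb_lt; lra |]. apply conn_snoc with q.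
      * revert IH. apply conn_incl. intros u; apply thick_mono, Rmin_l.
      * intros t Ht [k [Hk Hd]]. apply (H (seg q s t)) with k; auto.
        -- exists t; auto.
        -- rewrite dinf_sym. pose proof (Rmin_r r r'). lra.
Qed.

(* Every point outside the square is joined to one far corner. *)
Lemma conn_around_square c r p q : r <= dinf p c -> r <= dinf q c ->
  conn (fun u => dinf u c < r) p q.
Proof.
  intros Hp Hq.
  set (M := dinf p c + dinf q c + Rabs r + 1).
  assert (HM : forall u, r <= dinf u c -> dinf u c < M ->
    conn (fun u => dinf u c < r) u (fst c + M, snd c + M)).
  { clear. assert (Hr : r < M + 1 - 0 -> True) by auto. clear Hr. intros u Hu HuM.
    assert (HrM : r <= M) by lra.
    apply dinf_lt in HuM.
    assert (D : r <= fst u - fst c \/ r <= fst c - fst u \/ r <= snd u - snd c \/ r <= snd c - snd u).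
    { destruct (Rlt_le_dec (fst u - fst c) r); [| tauto].
      destruct (Rlt_le_dec (fst c - fst u) r); [| tauto].
      destruct (Rlt_le_dec (snd u - snd c) r); [| tauto].
      destruct (Rlt_le_dec (snd c - snd u) r); [| tauto].
      exfalso. apply (Rlt_irrefl r). apply Rle_lt_trans with (dinf u c); [exact Hu |].
      apply dinf_lt; lra. }
    clearbody M.
    assert (off : forall a b a' b',
      (a = a' /\ (r <= a - fst c \/ r <= fst c - a)) \/ (b = b' /\ (r <= b - snd c \/ r <= snd c - b)) ->
      conn (fun u => dinf u c < r) (a, b) (a', b')).
    { intros a b a' b' H. apply conn_seg. intros t Ht L. apply dinf_lt in L.
      unfold seg in L; simpl in L.
      destruct H as [[-> H] | [-> H]]; destruct H; nra. }
    destruct u as [a b]; simpl in *.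
    destruct D as [D | [D | [D | D]]].
    - apply conn_trans with (a, snd c + M); apply off; [left | right]; split; simpl; lra.
    - apply conn_trans with (a, snd c + M); apply off; [left | right]; split; simpl; lra.
    - apply conn_trans with (fst c + M, b); apply off; [right | left]; split; simpl; lra.
    - apply conn_trans with (fst c + M, b); apply off; [right | left]; split; simpl; lra. }
  pose proof (dinf_pos p c). pose proof (dinf_pos q c). pose proof (Rabs_pos r).
  apply conn_trans with (fst c + M, snd c + M); [| apply conn_sym]; apply HM; auto; unfold M; lra.
Qed.

(** An axis-parallel segment inside the square misses [c] as soon as its fixed coordinate differs
    from that of [c]; two such segments lead from any point to one common point. *)
Lemma conn_punctured_square c r p q : 0 < r -> p <> c -> q <> c -> dinf p c < r -> dinf q c < r ->
  conn (fun u => u = c \/ r <= dinf u c) p q.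
Proof.
  intros Hr Np Nq Hp Hq.
  assert (H : forall u, u <> c -> dinf u c < r ->
    conn (fun u => u = c \/ r <= dinf u c) u (fst c + r / 2, snd c + r / 2)).
  { clear p q Np Nq Hp Hq. intros [a b] N L.
    assert (off : forall a b a' b', dinf (a, b) c < r -> dinf (a', b') c < r ->
      (a = a' /\ a <> fst c) \/ (b = b' /\ b <> snd c) ->
      conn (fun u => u = c \/ r <= dinf u c) (a, b) (a', b')).
    { clear. intros a b a' b' L1 L2 H. apply conn_seg. intros t Ht [E | L].
      - unfold seg in E; destruct c as [c1 c2]; simpl in *. injection E as E1 E2.
        destruct H as [[-> H] | [-> H]]; apply H; lra.
      - pose proof (dinf_seg_ball c r (a, b) (a', b') t Ht L1 L2). lra. }
    pose proof (proj1 (dinf_lt _ _ _) L) as L'; simpl in L'.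
    destruct (Req_dec a (fst c)) as [E | Na].
    - assert (b <> snd c) by (intros E'; apply N; destruct c; simpl in *; congruence).
      apply conn_trans with (fst c + r / 2, b); apply off;
        try (apply dinf_lt; simpl; lra); [right | left]; split; simpl; lra.
    - apply conn_trans with (a, snd c + r / 2); apply off;
        try (apply dinf_lt; simpl; lra); [left | right]; split; simpl; lra. }
  apply conn_trans with (fst c + r / 2, snd c + r / 2); [| apply conn_sym]; apply H; auto.
Qed.

(** * Mod 2 chains on a grid *)

Fixpoint xsum (n : nat) (f : nat -> bool) : bool :=
  match n with O => false | S m => xorb (xsum m f) (f m) end.

Lemma xsum_ext n f g : (forall i, (i < n)%nat -> f i = g i) -> xsum n f = xsum n g.
Proof. intros H. induction n as [| n IH]; simpl; [auto |]. rewrite IH, H; auto. Qed.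

Lemma xsum_false n f : (forall i, (i < n)%nat -> f i = false) -> xsum n f = false.
Proof. intros H. induction n as [| n IH]; simpl; [auto |]. rewrite IH, H; auto. Qed.

Lemma xsum_xorb n f g : xsum n (fun i => xorb (f i) (g i)) = xorb (xsum n f) (xsum n g).
Proof. induction n as [| n IH]; simpl; [auto | rewrite IH; btauto]. Qed.

Lemma xsum_swap n m f :
  xsum n (fun i => xsum m (fun j => f i j)) = xsum m (fun j => xsum n (fun i => f i j)).
Proof.
  induction n as [| n IH]; simpl.
  - symmetry; apply xsum_false; auto.
  - now rewrite IH, xsum_xorb.
Qed.

Lemma xsum_single n f k : (k < n)%nat -> xsum n (fun i => (i =? k) && f i) = f k.
Proof.
  intros Hk. induction n as [| n IH]; [lia |]. simpl.
  destruct (Nat.eqb_spec n k) as [-> | N].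
  - rewrite xsum_false; [simpl; destruct (f k); auto |].
    intros i Hi. destruct (Nat.eqb_spec i k); [lia | auto].
  - rewrite IH by lia. simpl. apply xorb_false_r.
Qed.

(** Index shift with [false] before 0: chains vanish beyond the left and lower border of the
    grid. *)
Definition pred_val (f : nat -> bool) (i : nat) : bool :=
  match i with O => false | S k => f k end.

(* Mod 2 chains on the grid [nat * nat]: [H i j] is the coefficient of the edge from [(i, j)] to
   [(S i, j)], [V i j] that of the edge from [(i, j)] to [(i, S j)], and [C i j] that of the cell
   with lower left corner [(i, j)]. *)
Definition bd1 (H V : nat -> nat -> bool) (i j : nat) : bool :=
  xorb (xorb (H i j) (pred_val (fun k => H k j) i)) (xorb (V i j) (pred_val (V i) j)).
Definition bd2H (C : nat -> nat -> bool) (i j : nat) : bool := xorb (C i j) (pred_val (C i) j).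
Definition bd2V (C : nat -> nat -> bool) (i j : nat) : bool :=
  xorb (C i j) (pred_val (fun k => C k j) i).

Definition at_vertex (a : nat * nat) (i j : nat) : bool := (i =? fst a) && (j =? snd a).
Definition xor2 (F G : nat -> nat -> bool) (i j : nat) : bool := xorb (F i j) (G i j).

Lemma bd1_xor2 H V H' V' i j :
  bd1 (xor2 H H') (xor2 V V') i j = xorb (bd1 H V i j) (bd1 H' V' i j).
Proof. unfold bd1, xor2, pred_val; destruct i, j; btauto. Qed.

Lemma bd1_bd2 C i j : bd1 (bd2H C) (bd2V C) i j = false.
Proof. unfold bd1, bd2H, bd2V, pred_val; destruct i, j; btauto. Qed.

(** The ray criterion for the inside of a cycle: the parity of the vertical edges in the row of the
    cell, from the left border up to its own left side. *)
Definition cells_left (V : nat -> nat -> bool) (i j : nat) : bool := xsum (S i) (fun k => V k j).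

Lemma bd2V_cells_left V i j : bd2V (cells_left V) i j = V i j.
Proof. unfold bd2V, cells_left; destruct i; simpl; btauto. Qed.

(** Together with [bd2V_cells_left]: every cycle is a boundary. The cycle condition at [(i, j)]
    determines [H i j] from the preceding column and the vertical edges, and [bd2H (cells_left V)]
    obeys the same recursion in [i]. *)
Lemma bd2H_cells_left H V : (forall i j, bd1 H V i j = false) ->
  forall i j, bd2H (cells_left V) i j = H i j.
Proof.
  intros B i j. induction i as [| i IH].
  - specialize (B O j). unfold bd1, bd2H, cells_left in *; destruct j; simpl in *;
      destruct (H O 0%nat), (V O 0%nat) eqn:E; try discriminate; auto;
      destruct (H O (S j)), (V O (S j)), (V O j); auto; discriminate.
  - specialize (B (S i) j). unfold bd1 in B. simpl in B.
    assert (E : bd2H (cells_left V) (S i) j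
      = xorb (bd2H (cells_left V) i j) (xorb (V (S i) j) (pred_val (V (S i)) j))).
    { unfold bd2H, cells_left; destruct j; simpl; btauto. }
    rewrite E, IH. destruct (H (S i) j), (H i j), (V (S i) j), (pred_val (V (S i)) j);
      simpl in *; auto; discriminate.
Qed.

(** One-dimensional Stokes formula mod 2: an edge of [f] contributes the value of [g] at both its
    ends, and these two cancel. *)
Lemma sum_by_parts n f g : f n = false -> (forall i, f i = true -> g i = g (S i)) ->
  xsum (S n) (fun i => g i && xorb (f i) (pred_val f i)) = false.
Proof.
  intros Hn Hc.
  assert (E : forall m, xsum (S m) (fun i => g i && xorb (f i) (pred_val f i)) = g m && f m).
  { induction m as [| m IH].
    - simpl. btauto.
    - change (xsum (S (S m)) (fun i => g i && xorb (f i) (pred_val f i)))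
        with (xorb (xsum (S m) (fun i => g i && xorb (f i) (pred_val f i)))
                (g (S m) && xorb (f (S m)) (f m))).
      rewrite IH. specialize (Hc m). destruct (f m); [rewrite Hc by auto |]; btauto. }
  rewrite E, Hn. btauto.
Qed.

(** A function constant along the edges of a chain pairs to zero with its boundary [a + b]. With the
    indicator of a component as [g], this turns a chain into a connection without extracting a path
    from it. *)
Lemma chain_constant n H V a b (g : nat -> nat -> bool) :
  (forall i j, bd1 H V i j = xorb (at_vertex a i j) (at_vertex b i j)) ->
  (forall j, H n j = false) -> (forall i, V i n = false) ->
  (forall i j, H i j = true -> g i j = g (S i) j) ->
  (forall i j, V i j = true -> g i j = g i (S j)) ->
  (fst a <= n)%nat -> (snd a <= n)%nat -> (fst b <= n)%nat -> (snd b <= n)%nat ->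
  g (fst a) (snd a) = g (fst b) (snd b).
Proof.
  intros B Hn Vn Hc Vc A1 A2 B1 B2.
  set (hx i j := g i j && xorb (H i j) (pred_val (fun k => H k j) i)).
  set (vx i j := g i j && xorb (V i j) (pred_val (V i) j)).
  assert (EH : xsum (S n) (fun i => xsum (S n) (fun j => hx i j)) = false).
  { rewrite xsum_swap. apply xsum_false. intros j _.
    apply (sum_by_parts n (fun i => H i j) (fun i => g i j)); auto. }
  assert (EV : xsum (S n) (fun i => xsum (S n) (fun j => vx i j)) = false).
  { apply xsum_false. intros i _. apply (sum_by_parts n (V i) (g i)); auto. }
  assert (EP : forall c, (fst c <= n)%nat -> (snd c <= n)%nat ->
    xsum (S n) (fun i => xsum (S n) (fun j => at_vertex c i j && g i j)) = g (fst c) (snd c)).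
  { intros c C1 C2. rewrite <- (xsum_single (S n) (fun i => g i (snd c)) (fst c)) by lia.
    apply xsum_ext; intros i _. unfold at_vertex. destruct (i =? fst c); simpl andb.
    - apply xsum_single; lia.
    - apply xsum_false; auto. }
  assert (ES : xorb (g (fst a) (snd a)) (g (fst b) (snd b)) = false).
  { rewrite <- (EP a), <- (EP b) by auto. rewrite <- xsum_xorb.
    rewrite <- (xorb_false_r false). rewrite <- EH at 1. rewrite <- EV. rewrite <- xsum_xorb.
    apply xsum_ext; intros i _. rewrite <- !xsum_xorb. apply xsum_ext; intros j _.
    specialize (B i j). unfold bd1 in B. unfold hx, vx.
    destruct (g i j); rewrite ?andb_true_r, ?andb_false_r; [| reflexivity].
    rewrite <- B. btauto. }
  now apply xorb_eq.
Qed.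

(** * Alexander's lemma *)

(** The origin is shifted to [- o] so that natural indices reach every point of the square of radius
    [o] around 0. *)
Definition grid (o h : R) (i : nat) : R := - o + INR i * h.
Definition lat (o h : R) (i j : nat) : pt := (grid o h i, grid o h j).
Definition on_hedge (o h : R) (i j : nat) (p : pt) : Prop :=
  snd p = grid o h j /\ grid o h i <= fst p <= grid o h (S i).
Definition on_vedge (o h : R) (i j : nat) (p : pt) : Prop :=
  fst p = grid o h i /\ grid o h j <= snd p <= grid o h (S j).
Definition in_cell (o h : R) (i j : nat) (p : pt) : Prop :=
  grid o h i <= fst p <= grid o h (S i) /\ grid o h j <= snd p <= grid o h (S j).
(** Half-open cells, so that rounding to the lower left corner is unambiguous ([near_unique]). *)
Definition near (o h : R) (p : pt) (a : nat * nat) : Prop :=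
  grid o h (fst a) <= fst p < grid o h (S (fst a)) /\ grid o h (snd a) <= snd p < grid o h (S (snd a)).

Lemma grid_S o h i : grid o h (S i) = grid o h i + h.
Proof. unfold grid. rewrite S_INR. ring. Qed.

Lemma grid_mono o h i j : 0 < h -> (i <= j)%nat -> grid o h i <= grid o h j.
Proof. intros Hh L. unfold grid. apply le_INR in L. nra. Qed.

Lemma grid_lt_inv o h i j : 0 < h -> grid o h i < grid o h j -> (i < j)%nat.
Proof.
  intros Hh L. destruct (Nat.lt_ge_cases i j) as [H | H]; [exact H |].
  pose proof (grid_mono o h j i Hh H). lra.
Qed.

Lemma grid_floor o h x : 0 < h -> - o <= x -> exists i, grid o h i <= x < grid o h (S i).
Proof.
  intros Hh Hx.
  destruct (archimed ((x + o) / h)) as [A B].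
  set (k := (up ((x + o) / h) - 1)%Z).
  assert (E : (x + o) / h * h = x + o) by (field; lra).
  assert (Hk : (0 <= k)%Z).
  { assert (0 <= (x + o) / h) by (apply Rmult_le_reg_r with h; lra).
    assert (0 < up ((x + o) / h))%Z by (apply lt_IZR; lra). unfold k; lia. }
  exists (Z.to_nat k). unfold grid. rewrite S_INR, INR_IZR_INZ, Z2Nat.id by exact Hk.
  unfold k. rewrite minus_IZR. split; nra.
Qed.

Lemma near_exists o h p : 0 < h -> dinf p (0, 0) < o -> exists a, near o h p a.
Proof.
  intros Hh L%dinf_lt; simpl in L.
  destruct (grid_floor o h (fst p) Hh) as [i Hi]; [lra |].
  destruct (grid_floor o h (snd p) Hh) as [j Hj]; [lra |].
  exists (i, j); split; assumption.
Qed.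

Lemma near_bound o h N p a : 0 < h -> o < grid o h N -> dinf p (0, 0) < o -> near o h p a ->
  (fst a < N)%nat /\ (snd a < N)%nat.
Proof.
  intros Hh HN L%dinf_lt [H1 H2]; simpl in L.
  split; apply (grid_lt_inv o h _ _ Hh); lra.
Qed.

(** Homological substitute for a lattice path from [a] to [b] off [K]. The index bounds keep the
    support finite, so that chains can be summed over and filled. *)
Definition chain (K : pt -> Prop) (o h : R) (N : nat) (a b : nat * nat) : Prop :=
  exists H V,
    (forall i j, H i j = true -> ((i < N)%nat /\ (j <= N)%nat) /\ forall p, on_hedge o h i j p -> ~ K p) /\
    (forall i j, V i j = true -> ((i <= N)%nat /\ (j < N)%nat) /\ forall p, on_vedge o h i j p -> ~ K p) /\
    (forall i j, bd1 H V i j = xorb (at_vertex a i j) (at_vertex b i j)).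

Lemma chain_refl K o h N a : chain K o h N a a.
Proof.
  exists (fun _ _ => false), (fun _ _ => false). split; [discriminate | split; [discriminate |]].
  intros i j. rewrite xorb_nilpotent. unfold bd1; destruct i, j; reflexivity.
Qed.

Lemma chain_sym K o h N a b : chain K o h N a b -> chain K o h N b a.
Proof.
  intros [H [V [HH [HV B]]]]. exists H, V. split; [exact HH | split; [exact HV |]].
  intros i j. rewrite B. apply xorb_comm.
Qed.

Lemma chain_trans K o h N a b c : chain K o h N a b -> chain K o h N b c -> chain K o h N a c.
Proof.
  intros [H [V [HH [HV B]]]] [H' [V' [HH' [HV' B']]]]. exists (xor2 H H'), (xor2 V V').
  split; [| split].
  - intros i j E. unfold xor2 in E. destruct (H i j) eqn:E1; [apply HH, E1 |].
    apply HH'. now destruct (H' i j).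
  - intros i j E. unfold xor2 in E. destruct (V i j) eqn:E1; [apply HV, E1 |].
    apply HV'. now destruct (V' i j).
  - intros i j. rewrite bd1_xor2, B, B'. btauto.
Qed.

Lemma chain_hedge K o h N i j : (i < N)%nat -> (j <= N)%nat ->
  (forall p, on_hedge o h i j p -> ~ K p) -> chain K o h N (i, j) (S i, j).
Proof.
  intros Hi Hj Hoff. exists (at_vertex (i, j)), (fun _ _ => false).
  split; [| split].
  - intros i' j' E. unfold at_vertex in E; simpl in E. apply andb_prop in E as [E1 E2].
    apply Nat.eqb_eq in E1, E2; subst; auto.
  - discriminate.
  - intros i' j'. unfold bd1, at_vertex, pred_val; destruct i', j'; simpl; btauto.
Qed.

Lemma chain_vedge K o h N i j : (i <= N)%nat -> (j < N)%nat ->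
  (forall p, on_vedge o h i j p -> ~ K p) -> chain K o h N (i, j) (i, S j).
Proof.
  intros Hi Hj Hoff. exists (fun _ _ => false), (at_vertex (i, j)).
  split; [| split].
  - discriminate.
  - intros i' j' E. unfold at_vertex in E; simpl in E. apply andb_prop in E as [E1 E2].
    apply Nat.eqb_eq in E1, E2; subst; auto.
  - intros i' j'. unfold bd1, at_vertex, pred_val; destruct i', j'; simpl;
      rewrite ?andb_false_r; btauto.
Qed.

(** The two lattice points differ by at most one step in each direction, so at most one edge per
    direction joins them, and these edges stay within [3 * h] of [p]. *)
Lemma chain_near K o h N p p' a b : 0 < h -> o < grid o h N ->
  dinf p (0, 0) < o -> dinf p' (0, 0) < o -> near o h p a -> near o h p' b ->
  dinf p p' < h -> (forall u, dinf u p < 3 * h -> ~ K u) -> chain K o h N a b.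
Proof.
  intros Hh HN Bp Bp' Na Nb Hd Hoff.
  destruct (near_bound o h N p a) as [A1 A2]; auto.
  destruct (near_bound o h N p' b) as [B1 B2]; auto.
  destruct a as [i j], b as [i' j'], Na as [N1 N2], Nb as [N1' N2']; simpl in *.
  apply dinf_lt in Hd as [D1 D2].
  rewrite !grid_S in *.
  assert (I1 : (i < S (S i'))%nat) by (apply (grid_lt_inv o h _ _ Hh); rewrite !grid_S; lra).
  assert (I2 : (i' < S (S i))%nat) by (apply (grid_lt_inv o h _ _ Hh); rewrite !grid_S; lra).
  assert (J1 : (j < S (S j'))%nat) by (apply (grid_lt_inv o h _ _ Hh); rewrite !grid_S; lra).
  assert (J2 : (j' < S (S j))%nat) by (apply (grid_lt_inv o h _ _ Hh); rewrite !grid_S; lra).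
  apply chain_trans with (i', j).
  - assert (C : i' = i \/ i' = S i \/ i = S i') by lia.
    destruct C as [-> | [-> | ->]]; [apply chain_refl | | apply chain_sym];
      (apply chain_hedge; [lia | lia |]); intros u [E1 E2]; rewrite !grid_S in *;
      apply Hoff, dinf_lt; lra.
  - assert (C : j' = j \/ j' = S j \/ j = S j') by lia.
    destruct C as [-> | [-> | ->]]; [apply chain_refl | | apply chain_sym];
      (apply chain_vedge; [lia | lia |]); intros u [E1 E2]; rewrite !grid_S in *;
      apply Hoff, dinf_lt; lra.
Qed.

Lemma near_unique o h p a b : 0 < h -> near o h p a -> near o h p b -> a = b.
Proof.
  intros Hh [H1 H2] [H1' H2']. destruct a as [i j], b as [i' j']; simpl in *.
  assert ((i < S i')%nat) by (apply (grid_lt_inv o h _ _ Hh); lra).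
  assert ((i' < S i)%nat) by (apply (grid_lt_inv o h _ _ Hh); lra).
  assert ((j < S j')%nat) by (apply (grid_lt_inv o h _ _ Hh); lra).
  assert ((j' < S j)%nat) by (apply (grid_lt_inv o h _ _ Hh); lra).
  f_equal; lia.
Qed.

(** Rounding costs at most [3 * h <= d / 2] of the clearance [d]. The bound [M] depends on the
    polygonal line only, so that two lines can be rounded to the same grid. *)
Lemma chain_of_conn K d p q : 0 < d -> conn (thick K d) p q ->
  exists M, dinf p (0, 0) < M /\ dinf q (0, 0) < M /\ forall o h N a b, M < o -> 0 < h -> 6 * h <= d ->
    o < grid o h N -> near o h p a -> near o h q b -> chain (thick K (d / 2)) o h N a b.
Proof.
  intros Hd C. induction C as [p Hp | p q s C IH S].
  - exists (dinf p (0, 0) + 1); split; [lra | split; [lra |]].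
    intros o h N a b _ Hh _ _ Na Nb. rewrite (near_unique o h p a b); auto. apply chain_refl.
  - destruct IH as [M [Mp [Mq IH]]].
    set (M' := Rmax M (dinf s (0, 0) + 1)).
    pose proof (Rmax_l M (dinf s (0, 0) + 1)). pose proof (Rmax_r M (dinf s (0, 0) + 1)).
    fold M' in H, H0.
    exists M'; split; [lra | split; [lra |]].
    intros o h N a b HM Hh Hhd HN Na Nb.
    assert (Bd : forall t, 0 <= t <= 1 -> dinf (seg q s t) (0, 0) < o).
    { intros t Ht. apply dinf_seg_ball; auto; lra. }
    cut (forall b, near o h (seg q s 1) b -> chain (thick K (d / 2)) o h N a b).
    { intros H1; apply H1. now rewrite seg_1. }
    apply (unit_interval_induction
      (fun t => forall b, near o h (seg q s t) b -> chain (thick K (d / 2)) o h N a b)).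
    + intros t Ht. destruct (seg_near q s t (h / 2)) as [e [He Hn]]; [lra |].
      exists e; split; [exact He |]. intros u u' Hu Hu' Hut Hut' Hc b' Nb'.
      destruct (near_exists o h (seg q s u) Hh (Bd u Hu)) as [c Nc].
      apply chain_trans with c; [apply Hc, Nc |].
      apply (chain_near _ o h N (seg q s u) (seg q s u')); auto.
      * pose proof (dinf_tri (seg q s u) (seg q s t) (seg q s u')).
        rewrite (dinf_sym (seg q s t)) in H1.
        pose proof (Hn u Hut). pose proof (Hn u' Hut'). lra.
      * intros w Hw [k [Hk Hwk]]. apply (S u Hu). exists k; split; [exact Hk |].
        pose proof (dinf_tri (seg q s u) w k). rewrite (dinf_sym _ w) in H1. lra.
    + intros b' Nb'. rewrite seg_0 in Nb'. apply IH; auto; lra.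
Qed.

Lemma constant_between {A} (f : nat -> A) i k :
  (forall m, (i <= m < k \/ k <= m < i)%nat -> f m = f (S m)) -> f i = f k.
Proof.
  assert (W : forall i k, (i <= k)%nat -> (forall m, (i <= m < k)%nat -> f m = f (S m)) -> f i = f k).
  { clear. intros i k L. induction L as [| k L IH]; intros H; [reflexivity |].
    rewrite IH; [apply H; lia |]. intros m Hm; apply H; lia. }
  intros H. destruct (Nat.le_ge_cases i k); [| symmetry]; apply W; auto.
Qed.

Definition truth (P : Prop) : bool := if excluded_middle_informative P then true else false.

Lemma truth_spec P : truth P = true <-> P.
Proof. unfold truth; destruct excluded_middle_informative; split; auto; discriminate. Qed.

Lemma truth_iff P Q : (P <-> Q) -> truth P = truth Q.
Proof. unfold truth; do 2 destruct excluded_middle_informative; tauto. Qed.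

(** In a column beyond all horizontal edges the filling cannot change from one row to the next and
    starts with [false]; a row beyond all vertical edges has nothing to sum. *)
Lemma cells_left_support H V N : (forall i j, bd1 H V i j = false) ->
  (forall i j, H i j = true -> (i < N)%nat) -> (forall i j, V i j = true -> (j < N)%nat) ->
  forall i j, cells_left V i j = true -> (i < N)%nat /\ (j < N)%nat.
Proof.
  intros B HH HV i j E. split.
  - destruct (Nat.lt_ge_cases i N) as [L | L]; [exact L | exfalso].
    assert (Z : forall j, cells_left V i j = false).
    { intros j'. induction j' as [| j' IH].
      - pose proof (bd2H_cells_left H V B i 0%nat) as E'. unfold bd2H, pred_val in E'.
        rewrite xorb_false_r in E'. rewrite E'.
        destruct (H i 0%nat) eqn:E2; auto. apply HH in E2. lia.
      - pose proof (bd2H_cells_left H V B i (S j')) as E'. unfold bd2H, pred_val in E'.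
        rewrite IH, xorb_false_r in E'. rewrite E'.
        destruct (H i (S j')) eqn:E2; auto. apply HH in E2. lia. }
    rewrite Z in E; discriminate.
  - destruct (Nat.lt_ge_cases j N) as [L | L]; [exact L | exfalso].
    unfold cells_left in E. rewrite xsum_false in E; [discriminate |].
    intros k _. destruct (V k j) eqn:E2; auto. apply HV in E2. lia.
Qed.

(* Alexander's lemma. Grid chains [g1], [g2] from [z] to [q] avoiding [K1], [K2] bound a 2-chain
   [D], which may be taken to miss the neighbourhood of [y], so that no cell of [D] meets both sets;
   adding to [g1] the boundary of the cells of [D] that meet [K2] yields a chain avoiding both. *)
Lemma conn_union K1 K2 y z q : cpt K1 -> cpt K2 -> K1 y -> K2 y ->
  (forall p, K1 p -> K2 p -> p = y) ->
  conn K1 z q -> conn K2 z q -> conn (fun p => K1 p \/ K2 p) z q.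
Proof.
  intros HK1 HK2 Y1 Y2 HY C1 C2.
  destruct (conn_thick K1 z q HK1 C1) as [d1 [Hd1 T1]].
  destruct (conn_thick K2 z q HK2 C2) as [d2 [Hd2 T2]].
  set (d := Rmin d1 d2). assert (Hd : 0 < d) by (apply Rmin_glb_lt; lra).
  assert (T1' : conn (thick K1 d) z q).
  { revert T1; apply conn_incl; intros u; apply thick_mono, Rmin_l. }
  assert (T2' : conn (thick K2 d) z q).
  { revert T2; apply conn_incl; intros u; apply thick_mono, Rmin_r. }
  clear T1 T2. clearbody d. clear d1 Hd1 d2 Hd2.
  destruct (chain_of_conn K1 d z q Hd T1') as [M1 [M1z [M1q G1]]].
  destruct (chain_of_conn K2 d z q Hd T2') as [M2 [M2z [M2q G2]]].
  destruct (cpt_bounded K1 HK1) as [M3 [HM3 B3]].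
  destruct (cpt_bounded K2 HK2) as [M4 [HM4 B4]].
  (* By compactness, points of [K2] within [s] of [K1] lie close to the common point [y]. *)
  destruct (HK1 (fun c r => forall p, dinf p c < r -> K2 p -> dinf p y < d / 8)) as [s [Hs Hsep]].
  { intros c c' r r' H1 H2 p Hp Kp. apply H1; auto.
    pose proof (dinf_tri p c' c). rewrite (dinf_sym c' c) in *. lra. }
  { intros k Hk. destruct (classic (K2 k)) as [Hk2 | Hk2].
    - rewrite (HY k Hk Hk2). exists (d / 8); split; [lra | auto].
    - destruct (cpt_closed K2 k HK2 Hk2) as [r [Hr Hb]]. exists r; split; [exact Hr |].
      intros p Hp Kp. destruct (Hb p Hp Kp). }
  assert (HK : cpt (fun p => K1 p \/ K2 p)) by (apply cpt_union; auto).
  destruct (cpt_closed _ z HK) as [rz [Hrz Bz]].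
  { intros [H | H]; [exact (conn_left _ _ _ C1 H) | exact (conn_left _ _ _ C2 H)]. }
  destruct (cpt_closed _ q HK) as [rq [Hrq Bq]].
  { intros [H | H]; [exact (conn_right _ _ _ C1 H) | exact (conn_right _ _ _ C2 H)]. }
  (* The mesh: below [s], a cell meeting both sets is close to [y]; below [d / 16], all edges
     between such a cell and the cell of [y] are within [d / 2] of [y]; below [rz] and [rq], the end
     points are joined to their lattice points. *)
  assert (Hh : exists h, 0 < h /\ h < d / 16 /\ h < s /\ h < rz /\ h < rq).
  { exists (Rmin (Rmin (d / 16) s) (Rmin rz rq) / 2).
    pose proof (Rmin_l (d / 16) s). pose proof (Rmin_r (d / 16) s).
    pose proof (Rmin_l rz rq). pose proof (Rmin_r rz rq).
    pose proof (Rmin_l (Rmin (d / 16) s) (Rmin rz rq)).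
    pose proof (Rmin_r (Rmin (d / 16) s) (Rmin rz rq)).
    assert (0 < Rmin (Rmin (d / 16) s) (Rmin rz rq)).
    { repeat apply Rmin_glb_lt; lra. }
    repeat split; lra. }
  destruct Hh as [h [Hh [Hhd [Hhs [Hhz Hhq]]]]].
  assert (HR : exists o, M1 < o /\ M2 < o /\ M3 < o /\ M4 < o).
  { pose proof (dinf_pos z (0, 0)). exists (M1 + M2 + M3 + M4); repeat split; lra. }
  destruct HR as [o [R1 [R2 [R3 R4]]]].
  assert (HN : exists N, o < grid o h N).
  { destruct (grid_floor o h o Hh) as [N HN]; [lra |]. exists (S N); lra. }
  destruct HN as [N HN].
  destruct (near_exists o h z) as [a Na]; [auto | lra |].
  destruct (near_exists o h q) as [b Nb]; [auto | lra |].
  destruct (near_exists o h y) as [[iy jy] Ny]; [auto | specialize (B3 y Y1); lra |].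
  destruct (near_bound o h N z a) as [A1 A2]; auto; [lra |].
  destruct (near_bound o h N q b) as [A3 A4]; auto; [lra |].
  destruct (near_bound o h N y (iy, jy)) as [A5 A6]; auto; [specialize (B3 y Y1); simpl in *; lra |].
  destruct (G1 o h N a b) as [H1 [V1 [HH1 [HV1 E1]]]]; auto; [lra |].
  destruct (G2 o h N a b) as [H2 [V2 [HH2 [HV2 E2]]]]; auto; [lra |].
  clear G1 G2 T1' T2'. simpl in A5, A6. destruct Ny as [Ny1 Ny2]; simpl in Ny1, Ny2.
  set (H := xor2 H1 H2). set (V := xor2 V1 V2).
  assert (B : forall i j, bd1 H V i j = false).
  { intros i j. unfold H, V. rewrite bd1_xor2, E1, E2. apply xorb_nilpotent. }
  set (C := cells_left V).
  pose proof (bd2V_cells_left V) as CV. pose proof (bd2H_cells_left H V B) as CH. fold C in CV, CH.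
  assert (HV' : forall i j, V i j = true -> (j < N)%nat).
  { intros i j E. unfold V, xor2 in E. destruct (V1 i j) eqn:EV1.
    - apply HV1 in EV1; tauto.
    - apply (HV2 i j). now destruct (V2 i j). }
  assert (HH' : forall i j, H i j = true -> (i < N)%nat).
  { intros i j E. unfold H, xor2 in E. destruct (H1 i j) eqn:EH1.
    - apply HH1 in EH1; tauto.
    - apply (HH2 i j). now destruct (H2 i j). }
  pose proof (cells_left_support H V N B HH' HV') as CS. fold C in CS.
  (* If the filling covers the cell of [y], it is replaced by its complement in the [N] by [N] box.
     The boundary then changes only along the frame of the box, which [K2] does not reach. *)
  set (box i j := C iy jy && (i <? N)%nat && (j <? N)%nat).
  set (D := xor2 C box).
  assert (DS : forall i j, D i j = true -> (i < N)%nat /\ (j < N)%nat).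
  { intros i j E. unfold D, xor2 in E. destruct (C i j) eqn:EC; [apply CS, EC |].
    unfold box in E. destruct (Nat.ltb_spec i N), (Nat.ltb_spec j N); auto;
      rewrite ?andb_false_r in E; discriminate. }
  assert (noH : forall i j u, on_hedge o h i j u -> dinf u y < d / 2 -> H i j = false).
  { intros i j u Hu Hd'. unfold H, xor2. destruct (H1 i j) eqn:EH1; [exfalso | destruct (H2 i j) eqn:EH2].
    - apply HH1 in EH1 as [_ EH1]. apply (EH1 u Hu). exists y; auto.
    - exfalso. apply HH2 in EH2 as [_ EH2]. apply (EH2 u Hu). exists y; auto.
    - reflexivity. }
  assert (noV : forall i j u, on_vedge o h i j u -> dinf u y < d / 2 -> V i j = false).
  { intros i j u Hu Hd'. unfold V, xor2. destruct (V1 i j) eqn:EV1; [exfalso | destruct (V2 i j) eqn:EV2].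
    - apply HV1 in EV1 as [_ EV1]. apply (EV1 u Hu). exists y; auto.
    - exfalso. apply HV2 in EV2 as [_ EV2]. apply (EV2 u Hu). exists y; auto.
    - reflexivity. }
  (* A cell meeting both sets is close to [y]. No edge of the cycle comes within [d / 2] of [y], so
     [C] is constant from that cell to the cell of [y], where [D] is empty. *)
  assert (Dsep : forall i j u1 u2, D i j = true -> in_cell o h i j u1 -> in_cell o h i j u2 ->
    K1 u1 -> K2 u2 -> False).
  { intros i j u1 u2 HD I1 I2 U1 U2.
    destruct (DS i j HD) as [Di Dj].
    assert (L : dinf u2 y < d / 8).
    { apply (Hsep u1); auto. apply Rle_lt_trans with h; [| exact Hhs].
      unfold in_cell in I1, I2; rewrite !grid_S in *. apply dinf_le; lra. }
    apply dinf_lt in L. destruct I2 as [I2 I3]. rewrite !grid_S in *.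
    assert (Q1 : C i j = C iy j).
    { apply (constant_between (fun k => C k j)). intros m Hm.
      assert (EV : V (S m) j = false).
      { apply (noV (S m) j (grid o h (S m), grid o h j)).
        - split; simpl; rewrite ?grid_S; lra.
        - assert (grid o h i + h <= grid o h (S m) <= grid o h iy \/
                  grid o h iy + h <= grid o h (S m) <= grid o h i).
          { rewrite <- (grid_S o h i), <- (grid_S o h iy).
            destruct Hm; [left | right]; split; apply grid_mono; auto; lia. }
          apply dinf_lt; simpl. lra. }
      rewrite <- CV in EV. unfold bd2V, pred_val in EV. symmetry; now apply xorb_eq. }
    assert (Q2 : C iy j = C iy jy).
    { apply constant_between. intros m Hm.
      assert (EH : H iy (S m) = false).
      { apply (noH iy (S m) (grid o h iy, grid o h (S m))).
        - split; simpl; rewrite ?grid_S; lra.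
        - assert (grid o h j + h <= grid o h (S m) <= grid o h jy \/
                  grid o h jy + h <= grid o h (S m) <= grid o h j).
          { rewrite <- (grid_S o h j), <- (grid_S o h jy).
            destruct Hm; [left | right]; split; apply grid_mono; auto; lia. }
          apply dinf_lt; simpl. lra. }
      rewrite <- CH in EH. unfold bd2H, pred_val in EH. symmetry; now apply xorb_eq. }
    unfold D, xor2, box in HD. apply Nat.ltb_lt in Di, Dj.
    rewrite Di, Dj, Q1, Q2, !andb_true_r, xorb_nilpotent in HD. discriminate. }
  set (C' i j := D i j && truth (exists u, in_cell o h i j u /\ K2 u)).
  assert (C'S : forall i j, C' i j = true -> D i j = true /\ exists u, in_cell o h i j u /\ K2 u).
  { intros i j E. apply andb_prop in E as [E E']. split; [exact E | exact (proj1 (truth_spec _) E')]. }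
  assert (C'D : forall i j u, in_cell o h i j u -> K2 u -> C' i j = D i j).
  { intros i j u Hu U2. unfold C'. rewrite (proj2 (truth_spec _)); [apply andb_true_r | eauto]. }
  assert (C'K1 : forall i j u, in_cell o h i j u -> K1 u -> C' i j = false).
  { intros i j u Hu U1. destruct (C' i j) eqn:E; [exfalso | reflexivity].
    apply C'S in E as [E [u2 [I2 U2]]]. exact (Dsep i j u u2 E Hu I2 U1 U2). }
  set (H' := xor2 H1 (bd2H C')). set (V' := xor2 V1 (bd2V C')).
  (* At a point of [K1], the first chain and the cells of [C'] are both absent. At a point of [K2],
     the cells of [C'] and [D] around it coincide, so the new chain is the second chain plus the
     frame of the box. *)
  assert (offH : forall i j, H' i j = true -> forall u, on_hedge o h i j u -> ~ (K1 u \/ K2 u)).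
  { intros i j E u Hu [U | U].
    - assert (EH1 : H1 i j = false).
      { destruct (H1 i j) eqn:EH1; [exfalso | reflexivity].
        apply HH1 in EH1 as [_ EH1]. apply (EH1 u Hu), thick_incl; [lra | exact U]. }
      unfold H', xor2, bd2H in E. rewrite EH1, (C'K1 i j u) in E; auto.
      + destruct j as [| j]; [discriminate |]. simpl in E. rewrite (C'K1 i j u) in E; auto.
        discriminate. destruct Hu as [Q1 Q2]. split; [exact Q2 |]. rewrite !grid_S in *; lra.
      + destruct Hu as [Q1 Q2]. split; [exact Q2 |]. rewrite !grid_S in *; lra.
    - assert (EH2 : H2 i j = false).
      { destruct (H2 i j) eqn:EH2; [exfalso | reflexivity].
        apply HH2 in EH2 as [_ EH2]. apply (EH2 u Hu), thick_incl; [lra | exact U]. }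
      assert (X : H' i j = bd2H box i j).
      { assert (X1 : bd2H C' i j = bd2H D i j).
        { unfold bd2H. rewrite (C'D i j u); auto.
          - destruct j as [| j]; [reflexivity |]. simpl. rewrite (C'D i j u); auto.
            destruct Hu as [Q1 Q2]. split; [exact Q2 |]. rewrite !grid_S in *; lra.
          - destruct Hu as [Q1 Q2]. split; [exact Q2 |]. rewrite !grid_S in *; lra. }
        assert (X2 : bd2H D i j = xorb (H i j) (bd2H box i j)).
        { rewrite <- CH. unfold D, bd2H, xor2. destruct j; simpl; btauto. }
        unfold H', xor2. rewrite X1, X2. unfold H, xor2. rewrite EH2. btauto. }
      rewrite X in E. specialize (B4 u U). apply dinf_lt in B4; simpl in B4.
      destruct Hu as [Q1 Q2]. unfold bd2H, box, pred_val in E. destruct j as [| j].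
      + unfold grid in Q1. simpl in Q1. lra.
      + destruct (Nat.eq_dec (S j) N) as [EN | EN]; [rewrite EN in Q1; lra |].
        assert (((S j <? N) = (j <? N))%nat) as EE.
        { destruct (Nat.ltb_spec (S j) N), (Nat.ltb_spec j N); auto; lia. }
        rewrite EE, xorb_nilpotent in E. discriminate. }
  assert (offV : forall i j, V' i j = true -> forall u, on_vedge o h i j u -> ~ (K1 u \/ K2 u)).
  { intros i j E u Hu [U | U].
    - assert (EV1 : V1 i j = false).
      { destruct (V1 i j) eqn:EV1; [exfalso | reflexivity].
        apply HV1 in EV1 as [_ EV1]. apply (EV1 u Hu), thick_incl; [lra | exact U]. }
      unfold V', xor2, bd2V in E. rewrite EV1, (C'K1 i j u) in E; auto.
      + destruct i as [| i]; [discriminate |]. simpl in E. rewrite (C'K1 i j u) in E; auto.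
        discriminate. destruct Hu as [Q1 Q2]. split; [| exact Q2]. rewrite !grid_S in *; lra.
      + destruct Hu as [Q1 Q2]. split; [| exact Q2]. rewrite !grid_S in *; lra.
    - assert (EV2 : V2 i j = false).
      { destruct (V2 i j) eqn:EV2; [exfalso | reflexivity].
        apply HV2 in EV2 as [_ EV2]. apply (EV2 u Hu), thick_incl; [lra | exact U]. }
      assert (X : V' i j = bd2V box i j).
      { assert (X1 : bd2V C' i j = bd2V D i j).
        { unfold bd2V. rewrite (C'D i j u); auto.
          - destruct i as [| i]; [reflexivity |]. simpl. rewrite (C'D i j u); auto.
            destruct Hu as [Q1 Q2]. split; [| exact Q2]. rewrite !grid_S in *; lra.
          - destruct Hu as [Q1 Q2]. split; [| exact Q2]. rewrite !grid_S in *; lra. }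
        assert (X2 : bd2V D i j = xorb (V i j) (bd2V box i j)).
        { rewrite <- CV. unfold D, bd2V, xor2. destruct i; simpl; btauto. }
        unfold V', xor2. rewrite X1, X2. unfold V, xor2. rewrite EV2. btauto. }
      rewrite X in E. specialize (B4 u U). apply dinf_lt in B4; simpl in B4.
      destruct Hu as [Q1 Q2]. unfold bd2V, box, pred_val in E. destruct i as [| i].
      + unfold grid in Q1. simpl in Q1. lra.
      + destruct (Nat.eq_dec (S i) N) as [EN | EN]; [rewrite EN in Q1; lra |].
        assert (((S i <? N) = (i <? N))%nat) as EE.
        { destruct (Nat.ltb_spec (S i) N), (Nat.ltb_spec i N); auto; lia. }
        rewrite EE, xorb_nilpotent in E. discriminate. }
  set (K p := K1 p \/ K2 p) in *.
  assert (X : truth (conn K z (lat o h (fst a) (snd a))) = truth (conn K z (lat o h (fst b) (snd b)))).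
  { apply (chain_constant N H' V' a b (fun i j => truth (conn K z (lat o h i j)))); try lia.
    - intros i j. unfold H', V'. rewrite bd1_xor2, bd1_bd2, E1. apply xorb_false_r.
    - intros j. unfold H', xor2. destruct (H1 N j) eqn:EH1; [apply HH1 in EH1; lia |].
      assert (Z : forall j, C' N j = false).
      { intros j'. destruct (C' N j') eqn:E; [| reflexivity]. apply C'S in E as [E _].
        apply DS in E; lia. }
      unfold bd2H, pred_val. destruct j; now rewrite ?Z.
    - intros i. unfold V', xor2. destruct (V1 i N) eqn:EV1; [apply HV1 in EV1; lia |].
      assert (Z : forall i, C' i N = false).
      { intros i'. destruct (C' i' N) eqn:E; [| reflexivity]. apply C'S in E as [E _].
        apply DS in E; lia. }
      unfold bd2V, pred_val. destruct i; now rewrite ?Z.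
    - intros i j E. assert (Sg : seg_off K (lat o h i j) (lat o h (S i) j)).
      { intros t Ht. apply (offH i j E). unfold on_hedge, seg, lat; simpl; rewrite !grid_S.
        split; [lra | nra]. }
      apply truth_iff; split; intros Cn; eapply conn_snoc; eauto using seg_off_sym.
    - intros i j E. assert (Sg : seg_off K (lat o h i j) (lat o h i (S j))).
      { intros t Ht. apply (offV i j E). unfold on_vedge, seg, lat; simpl; rewrite !grid_S.
        split; [lra | nra]. }
      apply truth_iff; split; intros Cn; eapply conn_snoc; eauto using seg_off_sym. }
  assert (Ca : conn K z (lat o h (fst a) (snd a))).
  { apply (conn_ball K z rz); [exact Bz | rewrite dinf_refl; lra |].
    destruct Na as [N1 N2]; rewrite !grid_S in *. apply dinf_lt; unfold lat; simpl; lra. }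
  assert (Cb : conn K (lat o h (fst b) (snd b)) q).
  { apply (conn_ball K q rq); [exact Bq | | rewrite dinf_refl; lra].
    destruct Nb as [N1 N2]; rewrite !grid_S in *. apply dinf_lt; unfold lat; simpl; lra. }
  apply (proj2 (truth_spec _)) in Ca. rewrite X in Ca. apply (proj1 (truth_spec _)) in Ca.
  exact (conn_trans _ _ _ _ Ca Cb).
Qed.

(** * Arcs *)

Definition subarc (g : R -> pt) (a b : R) (p : pt) : Prop := exists t, a <= t <= b /\ p = g t.

(** An arc attached to [K] only at [g 1] separates nothing. It is grown backwards from [g 1]: each
    new piece lies in a square that excludes [z] and [q], hence does not separate them, and meets
    what is already there in one point, so [conn_union] applies. *)
Lemma conn_add_arc K g a z q : cpt K -> cont01 g -> inj01 g -> 0 <= a <= 1 -> K (g 1) ->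
  (forall t, a <= t < 1 -> ~ K (g t)) -> ~ subarc g a 1 z -> ~ subarc g a 1 q ->
  conn K z q -> conn (fun p => K p \/ subarc g a 1 p) z q.
Proof.
  intros HK Hg Hi Ha K1 Koff Hz Hq C.
  set (B s p := K p \/ subarc g s 1 p).
  (* As [u] runs from 0 to 1, the start of the added arc moves from 1 back to [a]. *)
  change (conn (B a) z q). replace a with (1 - 1 * (1 - a)) by ring.
  apply (unit_interval_induction (fun u => conn (B (1 - u * (1 - a))) z q)).
  - intros u0 Hu0. set (s0 := 1 - u0 * (1 - a)).
    assert (Hs0 : a <= s0 <= 1) by (unfold s0; nra).
    set (r := Rmin (dinf z (g s0)) (dinf q (g s0))).
    assert (Hr : 0 < r).
    { apply Rmin_glb_lt; apply dinf_sep; intros ->; [apply Hz | apply Hq]; exists s0; auto. }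
    destruct (cont01_dinf g s0 r Hg) as [e [He Hc]]; [lra | exact Hr |].
    exists e; split; [exact He |]. intros u u' Hu Hu' Hut Hut'.
    set (s := 1 - u * (1 - a)). set (s' := 1 - u' * (1 - a)).
    assert (Hs : a <= s <= 1) by (unfold s; nra).
    assert (Hs' : a <= s' <= 1) by (unfold s'; nra).
    apply Rabs_def2 in Hut; apply Rabs_def2 in Hut'.
    assert (Ds : - e < s - s0 < e) by (unfold s, s0; nra).
    assert (Ds' : - e < s' - s0 < e) by (unfold s', s0; nra).
    clearbody s s' s0. intros Cs.
    destruct (Rle_dec s s') as [L | L].
    + revert Cs. apply conn_incl. intros p [Hp | [t [Ht ->]]]; [left; exact Hp |].
      right; exists t; split; [lra | reflexivity].
    + apply (conn_incl _ (fun p => B s p \/ subarc g s' s p)).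
      { intros p [Hp | [t [Ht ->]]]; [left; left; exact Hp |].
        destruct (Rle_dec s t); [left; right | right]; exists t; split; auto; lra. }
      apply (conn_union (B s) (subarc g s' s) (g s)).
      * apply cpt_union; [exact HK | apply cpt_subarc; auto; lra].
      * apply cpt_subarc; auto; lra.
      * right; exists s; split; [lra | reflexivity].
      * exists s; split; [lra | reflexivity].
      * intros p [Hp | [t [Ht Et]]] [t' [Ht' ->]].
        -- destruct (Rlt_le_dec t' 1); [destruct (Koff t' ltac:(lra) Hp) |].
           f_equal; lra.
        -- assert (t' = t) by (apply Hi; auto; lra). f_equal; lra.
      * exact Cs.
      * apply (conn_incl _ (fun p => dinf p (g s0) < r)).
        -- intros p [t [Ht ->]]. apply Hc; [lra | apply Rabs_def1; lra].
        -- apply conn_around_square; [apply Rmin_l | apply Rmin_r].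
  - replace (1 - 0 * (1 - a)) with 1 by ring. revert C. apply conn_incl.
    intros p [Hp | [t [Ht ->]]]; [exact Hp |]. now replace t with 1 by lra.
Qed.

Lemma conn_subarc K g s t : cpt K -> cont01 g -> 0 <= s -> s <= t -> t <= 1 ->
  (forall u, s <= u <= t -> ~ K (g u)) -> conn K (g s) (g t).
Proof.
  intros HK Hg H0 Hst H1 Hoff.
  assert (C : conn K (g (s + 0 * (t - s))) (g (s + 1 * (t - s)))).
  { apply (conn_path K (fun u => g (s + u * (t - s)))); [exact HK | | intros u Hu; apply Hoff; nra].
    intros u Hu eps He. destruct (Hg (s + u * (t - s)) ltac:(nra) eps He) as [e [Hpe H]].
    exists e; split; [exact Hpe |]. intros v Hv Huv. apply H; [nra |].
    apply Rabs_def2 in Huv. apply Rabs_def1; nra. }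
  now replace (s + 0 * (t - s)) with s in C by ring; replace (s + 1 * (t - s)) with t in C by ring.
Qed.

(* [q] stands for its component of the complement of [G]. *)
Definition touches (G : pt -> Prop) (q w : pt) : Prop :=
  forall r, 0 < r -> exists u, dinf u w < r /\ conn G q u.

Lemma not_touches G q w : ~ touches G q w ->
  exists r, 0 < r /\ forall u, dinf u w < r -> ~ conn G q u.
Proof.
  intros H. apply not_all_ex_not in H as [r H]. apply imply_to_and in H as [Hr H].
  exists r; split; [exact Hr |]. intros u Hu C. apply H; eauto.
Qed.

Lemma touches_conn G q q' w : conn G q' q -> touches G q w -> touches G q' w.
Proof.
  intros C T r Hr. destruct (T r Hr) as [u [Hu Cu]].
  exists u; split; [exact Hu | exact (conn_trans _ _ _ _ C Cu)].
Qed.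

(** Otherwise interval induction would carry the face of [q] along the segment up to [w], which lies
    on [G]. Having the touched point on the segment keeps it in every square that contains [q] and
    [w]. *)
Lemma first_touch G q w : cpt G -> ~ G q -> G w ->
  exists t, 0 <= t <= 1 /\ G (seg q w t) /\ touches G q (seg q w t).
Proof.
  intros HG Hq Hw. apply NNPP. intros N.
  assert (C : conn G q w); [| exact (conn_right _ _ _ C Hw)].
  cut (conn G q (seg q w 1)); [now rewrite seg_1 |].
  apply (unit_interval_induction (fun t => conn G q (seg q w t)));
    [| rewrite seg_0; apply conn_refl, Hq].
  intros t Ht. destruct (classic (G (seg q w t))) as [Gt | Gt].
  - destruct (not_touches G q (seg q w t)) as [r [Hr H]].
    { intros T. apply N; eauto. }
    destruct (seg_near q w t r Hr) as [e [He Hn]]. exists e; split; [exact He |].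
    intros s s' _ _ Hs _ Cs. destruct (H _ (Hn s Hs) Cs).
  - destruct (cpt_closed G _ HG Gt) as [r [Hr H]].
    destruct (seg_near q w t r Hr) as [e [He Hn]]. exists e; split; [exact He |].
    intros s s' _ _ Hs Hs' Cs. apply conn_trans with (seg q w s); [exact Cs |].
    apply (conn_ball G (seg q w t) r); auto.
Qed.

(* The sub-arc of [g] near [g 0] that the face of [q] does not touch is no barrier for that face, so
   the face would reach the arc itself by [conn_add_arc]. *)
Lemma touches_arc_start K g q t : cpt K -> cont01 g -> inj01 g -> K (g 1) ->
  (forall s, 0 < s < 1 -> ~ K (g s)) -> 0 < t < 1 ->
  let G p := K p \/ subarc g 0 1 p in
  ~ G q -> touches G q (g t) -> touches G q (g 0).
Proof.
  intros HK Hg Hi K1 Koff Ht G Hq Tt. apply NNPP. intros N.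
  destruct (not_touches G q (g 0) N) as [r [Hr Hoff]].
  destruct (cont01_dinf g 0 r Hg) as [e [He Hc]]; [lra | exact Hr |].
  (* [a < t] leaves [g t] on the remaining arc; [a < e] keeps the cut-off piece in the square around
     [g 0] that the face avoids. *)
  assert (Ha : exists a, 0 < a /\ a < t /\ a < e).
  { exists (Rmin t e / 2). pose proof (Rmin_l t e). pose proof (Rmin_r t e).
    assert (0 < Rmin t e) by (apply Rmin_glb_lt; lra). repeat split; lra. }
  destruct Ha as [a [Ha0 [Hat Hae]]].
  assert (Hball : forall s, 0 <= s <= a -> dinf (g s) (g 0) < r).
  { intros s Hs. apply Hc; [lra | apply Rabs_def1; lra]. }
  assert (HG : cpt G) by (apply cpt_union; [exact HK | apply cpt_subarc; auto; lra]).
  destruct (cpt_closed K (g t) HK (Koff t Ht)) as [r1 [Hr1 Hb1]].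
  destruct (Tt r1 Hr1) as [q1 [Hq1 Cq1]].
  set (z := g (a / 2)).
  (* With the whole arc removed, the arc itself serves as the way from [z] to [g t]. *)
  assert (CK : conn K z q1).
  { apply conn_trans with (g t).
    - apply conn_subarc; auto; try lra. intros u Hu. apply Koff; lra.
    - apply (conn_ball K (g t) r1); [exact Hb1 | rewrite dinf_refl; exact Hr1 | exact Hq1]. }
  assert (CJ : conn (fun p => K p \/ subarc g a 1 p) z q1).
  { apply conn_add_arc; auto; try lra.
    - intros u Hu. apply Koff; lra.
    - intros [u [Hu E]]. assert (a / 2 = u) by (apply Hi; auto; lra). lra.
    - intros Q. apply (conn_right _ _ _ Cq1). right. destruct Q as [u [Hu E]].
      exists u; split; [lra | exact E]. }
  apply conn_sym in CJ.
  (* Following the connection from [q1] to [z], the face of [q] could be left only at a point of the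
     cut-off piece, and near that piece the face has no points. So [z] would be in the face although
     it lies on [G]. *)
  assert (Cz : conn G q z).
  { refine (conn_induction _ (conn G q) _ _ _ CJ Cq1).
    intros w Hw. destruct (classic (G w)) as [Gw | Gw].
    - assert (Hw' : dinf w (g 0) < r).
      { destruct Gw as [Gw | [s [Hs ->]]]; [tauto |]. apply Hball.
        destruct (Rle_dec s a); [lra |]. exfalso; apply Hw; right; exists s; split; [lra | reflexivity]. }
      exists (r - dinf w (g 0)); split; [lra |]. intros u u' Hu _ _ _ Cu.
      apply (Hoff u) in Cu; [destruct Cu |]. pose proof (dinf_tri u w (g 0)). lra.
    - destruct (cpt_closed G w HG Gw) as [r2 [Hr2 Hb2]]. exists r2; split; [exact Hr2 |].
      intros u u' Hu Hu' _ _ Cu. apply conn_trans with u; [exact Cu |].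
      apply (conn_ball G w r2); auto. }
  apply (conn_right _ _ _ Cz). right. exists (a / 2); split; [lra | reflexivity].
Qed.

(* Removing an interior point disconnects an arc but not a square. *)
Lemma arc_no_square g t r : cont01 g -> inj01 g -> 0 < t < 1 -> 0 < r ->
  exists p, dinf p (g t) < r /\ ~ subarc g 0 1 p.
Proof.
  intros Hg Hi Ht Hr. apply NNPP. intros N.
  assert (HB : forall p, dinf p (g t) < r -> subarc g 0 1 p).
  { intros p Hp. apply NNPP. intros H. apply N; eauto. }
  destruct (cont01_dinf g t r Hg) as [e [He Hc]]; [lra | exact Hr |].
  assert (Hs : exists s, 0 < s /\ s < e /\ s < t /\ s < 1 - t).
  { exists (Rmin e (Rmin t (1 - t)) / 2).
    pose proof (Rmin_l e (Rmin t (1 - t))). pose proof (Rmin_r e (Rmin t (1 - t))).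
    pose proof (Rmin_l t (1 - t)). pose proof (Rmin_r t (1 - t)).
    assert (0 < Rmin e (Rmin t (1 - t))) by (repeat apply Rmin_glb_lt; lra).
    repeat split; lra. }
  destruct Hs as [s [Hs [Hse [Hst Hst']]]].
  assert (C : conn (fun u => u = g t \/ r <= dinf u (g t)) (g (t - s)) (g (t + s))).
  { apply conn_punctured_square; auto.
    - intros E. apply Hi in E; lra.
    - intros E. apply Hi in E; lra.
    - apply Hc; [lra | apply Rabs_def1; lra].
    - apply Hc; [lra | apply Rabs_def1; lra]. }
  (* If the arc filled the square, its two halves would both be closed in the punctured square, so
     lying on the first half is locally constant there. *)
  assert (Q : subarc g 0 t (g (t + s))).
  { refine (conn_induction _ (subarc g 0 t) _ _ _ C _).
    - intros w Hw. destruct (HB w) as [u [Hu ->]].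
      { apply Rnot_le_lt; tauto. }
      assert (u <> t) by (intros ->; tauto).
      destruct (Rlt_le_dec u t).
      + destruct (cpt_closed (subarc g t 1) (g u)) as [r1 [Hr1 Hb]].
        { apply cpt_subarc; auto; lra. }
        { intros [v [Hv E]]. apply Hi in E; lra. }
        exists r1; split; [exact Hr1 |]. intros v v' _ Hv' _ Kv' _.
        destruct (HB v') as [x [Hx ->]]; [apply Rnot_le_lt; tauto |].
        exists x; split; [| reflexivity]. destruct (Rle_dec t x); [| lra].
        exfalso. apply (Hb _ Hv'). exists x; split; [lra | reflexivity].
      + destruct (cpt_closed (subarc g 0 t) (g u)) as [r1 [Hr1 Hb]].
        { apply cpt_subarc; auto; lra. }
        { intros [v [Hv E]]. apply Hi in E; lra. }
        exists r1; split; [exact Hr1 |]. intros v v' Hv _ _ _ Sv. destruct (Hb _ Hv Sv).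
    - exists (t - s); split; [lra | reflexivity]. }
  destruct Q as [u [Hu E]]. apply Hi in E; lra.
Qed.

(** * Connected domination *)

Section ConnectedDomination.
Local Open Scope nat_scope.
Variable A : nat -> nat -> Prop.
Hypothesis A_sym : forall u v, A u v -> A v u.

(** Lists, latest vertex first, whose vertices carry a spanning 2-tree of [A]. *)
Inductive built : list nat -> Prop :=
| built_edge a b : a <> b -> A a b -> built [a; b]
| built_cons v l a b : built l -> ~ In v l -> In a l -> In b l -> a <> b ->
    A a b -> A v a -> A v b -> built (v :: l).

(** Connectedness phrased by propagation of properties instead of paths, which is the form in which
    it is finally applied to the plane. *)
Definition linked (U : list nat) : Prop :=
  forall P : nat -> Prop, (forall u v, In u U -> In v U -> A u v -> P u -> P v) ->
    forall u v, In u U -> In v U -> P u -> P v.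

Definition dominates (U l : list nat) : Prop :=
  forall v, In v l -> In v U \/ exists u, In u U /\ A v u.

Definition touches_edge (U : list nat) (e : nat * nat) : Prop := In (fst e) U \/ In (snd e) U.

Definition is_edge (l : list nat) (e : nat * nat) : Prop :=
  In (fst e) l /\ In (snd e) l /\ fst e <> snd e /\ A (fst e) (snd e).

Lemma linked_single v : linked [v].
Proof. intros P H u w [<- | []] [<- | []]; auto. Qed.

Lemma linked_cons v u U : linked U -> In u U -> A v u -> linked (v :: U).
Proof.
  intros L Hu E P H.
  assert (HU : forall x y, In x U -> In y U -> P x -> P y).
  { apply L. intros x y Hx Hy; apply H; right; assumption. }
  assert (P v <-> P u) by (split; apply H; simpl; auto).
  intros x y [<- | Hx] [<- | Hy] Px; auto.
  - apply (HU u); tauto.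
  - apply H0, (HU x); auto.
  - apply (HU x); auto.
Qed.

Lemma built_NoDup l : built l -> NoDup l.
Proof.
  induction 1.
  - constructor; [simpl; intuition | constructor; [simpl; auto | constructor]].
  - constructor; auto.
Qed.

Lemma built_length l : built l -> 2 <= length l.
Proof. induction 1; simpl; lia. Qed.

Lemma built_neighbour l u : built l -> In u l -> exists v, In v l /\ v <> u /\ A u v.
Proof.
  induction 1 as [a b N E | v l a b B IH Hv Ha Hb N E Ea Eb].
  - intros [<- | [<- | []]]; [exists b | exists a]; simpl; auto.
  - intros [<- | Hu].
    + exists a; simpl; repeat split; auto. intros ->; auto.
    + destruct (IH Hu) as [w [Hw H]]. exists w; simpl; auto.
Qed.

Lemma built_small_complete l : built l -> length l <= 3 ->
  forall u v, In u l -> In v l -> u <> v -> A u v.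
Proof.
  intros [a b N E | v l' a b B Hv Ha Hb N E Ea Eb] L x y.
  - intros [<- | [<- | []]] [<- | [<- | []]]; tauto || auto.
  - destruct B as [c d N' E' | w l'' c d B]; [| apply built_length in B; simpl in L; lia].
    assert (Ec : A v c /\ A v d).
    { destruct Ha as [<- | [<- | []]], Hb as [<- | [<- | []]]; tauto. }
    intros [<- | [<- | [<- | []]]] [<- | [<- | [<- | []]]]; tauto || (intros _; apply A_sym; tauto) || tauto.
Qed.

(** [F] holds the demands of vertices already removed: if the edge [(a, b)] is covered, a vertex
    attached to [a] and [b] is dominated and can be joined to [U]. *)
Definition cds (l : list nat) (F : list (nat * nat)) (U : list nat) : Prop :=
  U <> [] /\ incl U l /\ linked U /\ dominates U l /\ (forall e, In e F -> touches_edge U e).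

Lemma cds_cons l F U u : cds l F U -> In u l -> cds l F (u :: U).
Proof.
  intros [N [I [L [D T]]]] Hu. repeat split.
  - discriminate.
  - intros x [<- | Hx]; auto.
  - destruct (D u Hu) as [H | [w [Hw E]]].
    + intros P H' x y Hx Hy.
      assert (forall x, In x (u :: U) -> In x U) by (intros z [<- | Hz]; auto).
      apply L; auto. intros v v' Hv Hv'; apply H'; right; assumption.
    + now apply (linked_cons u w).
  - intros v Hv. destruct (D v Hv) as [H | [w [Hw E]]]; [left; right; auto | right].
    exists w; split; [right |]; auto.
  - intros e He. destruct (T e He); [left | right]; right; assumption.
Qed.

(** The totals too small for the bound with the spare one: [l] is a triangle and [F] is empty, or
    [l] is a single edge, which any of its ends covers. *)
Lemma cds_single l F u : built l -> length l + length F <= 3 -> In u l ->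
  (forall e, In e F -> is_edge l e) -> cds l F [u].
Proof.
  intros B Hl Hu HF. repeat split.
  - discriminate.
  - intros x [<- | []]; exact Hu.
  - apply linked_single.
  - intros v Hv. destruct (Nat.eq_dec v u) as [-> | N]; [left; simpl; auto | right].
    exists u; split; [simpl; auto |]. apply (built_small_complete l); auto; lia.
  - intros e He. destruct (HF e He) as [H1 [H2 [H3 _]]].
    destruct B as [a b N E | v l' a b B]; [| apply built_length in B; destruct F; simpl in *; [tauto | lia]].
    unfold touches_edge; simpl in *. intuition congruence.
Qed.

(** The spare one in the bound is spent on forcing a given vertex into the set. *)
Lemma cds_with_vertex l :
  built l ->
  (forall F, (forall e, In e F -> is_edge l e) -> 4 <= length l + length F ->
    exists U, cds l F U /\ 2 * length U + 2 <= length l + length F) ->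
  forall F u, (forall e, In e F -> is_edge l e) -> In u l ->
    exists U, cds l F U /\ In u U /\ 2 * length U <= length l + length F.
Proof.
  intros B IH F u HF Hu. destruct (Nat.le_gt_cases 4 (length l + length F)) as [G | G].
  - destruct (IH F HF G) as [U [C L]]. exists (u :: U); split; [apply cds_cons; auto |].
    simpl; split; [auto | lia].
  - exists [u]; split; [apply cds_single; auto; lia |].
    pose proof (built_length l B). simpl; split; [auto | lia].
Qed.

Lemma cds_grow v l F U F' : cds l F' U -> (exists u, In u U /\ A v u) ->
  (forall e, In e F -> touches_edge U e) -> cds (v :: l) F U.
Proof.
  intros [N [I [L [D T]]]] [u [Hu E]] HF. repeat split; auto.
  - intros x Hx; right; auto.
  - intros x [<- | Hx]; [right; exists u | apply D]; auto.
Qed.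

Lemma filter_split {X} (f : X -> bool) (F : list X) :
  length F = length (filter f F) + length (filter (fun x => negb (f x)) F).
Proof. induction F as [| x F IH]; simpl; [auto |]. destruct (f x); simpl; lia. Qed.

(* Induction on the construction sequence, by the number of prescribed edges at the last vertex [v]:
   if there is none, prescribe instead the edge [a b] to which [v] was attached; if there is one, add
   its other end; if there are at least two, add [v] itself. *)
Lemma connected_domination l : built l -> forall F, (forall e, In e F -> is_edge l e) ->
  4 <= length l + length F -> exists U, cds l F U /\ 2 * length U + 2 <= length l + length F.
Proof.
  intros B. induction B as [a b N E | v l a b B IH Hv Ha Hb N E Ea Eb]; intros F HF L.
  - exists [a]; split; [| simpl in *; lia]. repeat split.
    + discriminate.
    + intros x [<- | []]; simpl; auto.
    + apply linked_single.
    + intros x [<- | [<- | []]]; [left; simpl; auto | right; exists a; simpl; auto].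
    + intros e He. destruct (HF e He) as [H1 [H2 [H3 _]]].
      unfold touches_edge; simpl in *. intuition congruence.
  - set (at_v (e : nat * nat) := (fst e =? v) || (snd e =? v)).
    set (F1 := filter at_v F). set (F2 := filter (fun e => negb (at_v e)) F).
    pose proof (filter_split at_v F) as LF. fold F1 F2 in LF.
    assert (H1 : forall e, In e F1 -> fst e = v /\ In (snd e) l /\ A v (snd e)
      \/ snd e = v /\ In (fst e) l /\ A v (fst e)).
    { intros e He. apply filter_In in He as [He H]. destruct (HF e He) as [Q1 [Q2 [Q3 Q4]]].
      unfold at_v in H. apply orb_prop in H as [H | H]; apply Nat.eqb_eq in H; [left | right].
      - destruct Q2 as [Q2 | Q2]; [congruence |]. rewrite H in Q4; auto.
      - destruct Q1 as [Q1 | Q1]; [congruence |]. rewrite H in Q4; auto. }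
    assert (H2 : forall e, In e F2 -> is_edge l e).
    { intros e He. apply filter_In in He as [He H]. destruct (HF e He) as [Q1 [Q2 [Q3 Q4]]].
      unfold at_v in H. apply negb_true_iff, orb_false_elim in H as [H H'].
      apply Nat.eqb_neq in H, H'.
      destruct Q1 as [Q1 | Q1]; [congruence |]. destruct Q2 as [Q2 | Q2]; [congruence |].
      repeat split; auto. }
    assert (H3 : forall e, In e F -> In e F1 \/ In e F2).
    { intros e He. destruct (at_v e) eqn:Q; [left | right]; apply filter_In; split; auto.
      now rewrite Q. }
    assert (H4 : forall e, In e ((a, b) :: F2) -> is_edge l e).
    { intros e [<- | He]; [repeat split; auto | auto]. }
    assert (H5 : forall U, touches_edge U (a, b) -> exists u, In u U /\ A v u).
    { intros U [H | H]; [exists a | exists b]; auto. }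
    simpl in L |- *.
    destruct F1 as [| e F1'] eqn:EF1; [| destruct F1' as [| e' F1'']]; simpl in LF.
    (* The total is unchanged: the demand [(a, b)] takes the place of [v]. *)
    + destruct (IH ((a, b) :: F2) H4) as [U [C LU]]; [simpl; lia |].
      exists U; split; [| simpl in LU; lia]. apply (cds_grow v l F U _ C).
      * apply H5, C; left; reflexivity.
      * intros e He. apply C; right. destruct (H3 e He) as [[] |]; auto.
    (* Dropping [v] and its edge lowers the total by 2, just enough for the weaker bound of
       [cds_with_vertex]. The forced vertex [u] both covers the edge and dominates [v]. *)
    + assert (Hu : exists u, In u l /\ A v u /\ forall U, In u U -> touches_edge U e).
      { destruct (H1 e (or_introl eq_refl)) as [[Q [Q' Q'']] | [Q [Q' Q'']]];
          [exists (snd e) | exists (fst e)]; repeat split; auto; intros U HU; [right | left]; auto. }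
      destruct Hu as [u [Hu [Evu Tu]]].
      destruct (cds_with_vertex l B IH F2 u H2 Hu) as [U [C [HuU LU]]].
      exists U; split; [| lia]. apply (cds_grow v l F U _ C); [eauto |].
      intros e' He'. destruct (H3 e' He') as [[<- | []] | He2]; [apply Tu, HuU | apply C, He2].
    (* Replacing [v] and at least two edges by the demand [(a, b)] lowers the total by at least 2,
       which pays for adding [v]; the demand guarantees that [v] is adjacent to the set. *)
    + destruct (Nat.le_gt_cases 4 (length l + length ((a, b) :: F2))) as [G | G].
      * destruct (IH ((a, b) :: F2) H4 G) as [U [C LU]].
        exists (v :: U); split; [| simpl in *; lia].
        assert (Hu : exists u, In u U /\ A v u) by (apply H5, C; left; reflexivity).
        destruct C as [N' [I [Lk [D T]]]]. repeat split.
        -- discriminate.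
        -- intros x [<- | Hx]; [left | right]; auto.
        -- destruct Hu as [u [Hu Evu]]. now apply (linked_cons v u).
        -- intros x [<- | Hx]; [left; left; auto |].
           destruct (D x Hx) as [Q | [w [Q Q']]]; [left; right; auto | right; exists w; split; [right |]; auto].
        -- intros f Hf. destruct (H3 f Hf) as [Hf1 | Hf2].
           ++ destruct (H1 f Hf1) as [[Q _] | [Q _]]; [left | right]; left; auto.
           ++ destruct (T f (or_intror Hf2)); [left | right]; right; auto.
      (* Here [l] is the edge [a b] alone and [F2] is empty, so [v] by itself suffices. *)
      * simpl in G. pose proof (built_length l B).
        assert (EF2 : F2 = []) by (destruct F2; simpl in *; [reflexivity | lia]).
        exists [v]; split; [| simpl in *; lia]. repeat split.
        -- discriminate.
        -- intros x [<- | []]; left; auto.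
        -- apply linked_single.
        -- intros x [<- | Hx]; [left; left; auto | right; exists v; split; [left; auto |]].
           destruct B as [c d N' E' | w l'' c d B]; [| apply built_length in B; simpl in *; lia].
           simpl in Ha, Hb, Hx.
           destruct Hx as [<- | [<- | []]]; apply A_sym;
             destruct Ha as [<- | [<- | []]], Hb as [<- | [<- | []]]; tauto.
        -- intros f Hf. destruct (H3 f Hf) as [Hf1 | Hf2]; [| rewrite EF2 in Hf2; destruct Hf2].
           destruct (H1 f Hf1) as [[Q _] | [Q _]]; [left | right]; left; auto.
Qed.

Lemma connected_domination_from l a : built l -> In a l ->
  exists U, In a U /\ incl U l /\ linked U /\ dominates U l /\ 2 * length U <= length l.
Proof.
  intros B Ha.
  destruct (cds_with_vertex l B (connected_domination l B) [] a) as [U [[_ [I [L [D _]]]] [HU LU]]]; auto.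
  - intros e [].
  - exists U; simpl in LU; repeat split; auto; lia.
Qed.

(** If the list misses a vertex, connectedness gives an edge leaving it at some [x]. Then [x] has
    neighbours inside and outside the list, and local connectedness yields two adjacent ones, [a]
    inside and [b] outside: [b] is attached to the edge [x a]. *)
Lemma built_spanning n : 2 <= n ->
  (forall S : nat -> Prop, (exists u, u < n /\ S u) -> (exists v, v < n /\ ~ S v) ->
     exists u v, u < n /\ v < n /\ S u /\ ~ S v /\ A u v) ->
  (forall x (S : nat -> Prop), x < n ->
     (exists y, y < n /\ y <> x /\ A x y /\ S y) -> (exists y, y < n /\ y <> x /\ A x y /\ ~ S y) ->
     exists y z, y < n /\ z < n /\ y <> x /\ z <> x /\ A x y /\ A x z /\ S y /\ ~ S z /\ A y z) ->
  exists l, built l /\ forall v, v < n <-> In v l.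
Proof.
  intros Hn HC HL.
  assert (HB : forall k, 2 <= k -> k <= n ->
    exists l, built l /\ length l = k /\ forall v, In v l -> v < n).
  { induction k as [| k IH]; intros Hk2 Hk; [lia |]. destruct (Nat.eq_dec k 1) as [-> | N].
    - destruct (HC (fun v => v = 0)) as [u [v [Hu [Hv [Su [Sv E]]]]]].
      { exists 0; split; [lia | auto]. } { exists 1; split; [lia | auto]. }
      exists [u; v]; split; [constructor; auto; congruence |]. split; [reflexivity |].
      intros x [<- | [<- | []]]; auto.
    - destruct IH as [l [B [Ll Hl]]]; [lia | lia |].
      assert (Hout : exists v, v < n /\ ~ In v l).
      { apply NNPP. intros H. assert (I : incl (seq 0 n) l).
        { intros v Hv. apply NNPP; intros H'. apply H. exists v.
          apply in_seq in Hv; split; [lia | auto]. }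
        apply NoDup_incl_length in I; [| apply seq_NoDup]. rewrite length_seq in I. lia. }
      assert (Hin : exists u, u < n /\ In u l).
      { destruct l as [| u l]; [simpl in Ll; lia |]. exists u; split; [apply Hl |]; left; auto. }
      destruct (HC (fun v => In v l) Hin Hout) as [x [v [Hx [Hv [Sx [Sv E]]]]]].
      destruct (built_neighbour l x B Sx) as [y [Hy [Ny Ey]]].
      destruct (HL x (fun v => In v l) Hx) as [a [b [Qa [Qb [Na [Nb [Ea [Eb [Sa [Sb Eab]]]]]]]]]].
      { exists y; auto. }
      { exists v; repeat split; auto. intros ->; auto. }
      exists (b :: l). split; [apply (built_cons b l x a); auto |]. split; [simpl; lia |].
      intros w [<- | Hw]; auto. }
  destruct (HB n Hn (le_n n)) as [l [B [Ll Hl]]]. exists l; split; [exact B |].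
  intros v; split; [| apply Hl]. intros Hv.
  apply (NoDup_length_incl (built_NoDup l B) (l' := seq 0 n)).
  - rewrite length_seq; lia.
  - intros w Hw. apply in_seq. specialize (Hl w Hw). lia.
  - apply in_seq; lia.
Qed.

End ConnectedDomination.

(** * Cofacial vertices of a drawing *)

Section Drawing.
Variables (n : nat) (E : nat -> nat -> Prop).
Hypothesis HG : simple_graph n E.
Variable D : drawing n E.

(** One shape for the whole drawing, the drawing without an edge, the part away from a vertex and
    the induced drawing, so that compactness is proved once. *)
Definition part (P : nat -> Prop) (Q : nat -> nat -> Prop) (p : pt) : Prop :=
  (exists w, (w < n)%nat /\ P w /\ p = pos D w) \/
  (exists u v, E u v /\ Q u v /\ exists t, 0 <= t <= 1 /\ p = arc D u v t).

Lemma part_cpt P Q : cpt (part P Q).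
Proof.
  apply cpt_union.
  - apply (cpt_bunion n (fun w p => P w /\ p = pos D w)). intros w.
    apply cpt_guard; intros _; apply cpt_point.
  - apply (cpt_ext (fun p => exists u, (u < n)%nat /\ exists v, (v < n)%nat /\
      ((E u v /\ Q u v) /\ exists t, 0 <= t <= 1 /\ p = arc D u v t))).
    + intros p; split.
      * intros [u [_ [v [_ [[H1 H2] H3]]]]]. exists u, v; auto.
      * intros [u [v [H1 [H2 H3]]]]. destruct HG as [_ [_ B]]. destruct (B u v H1).
        exists u; split; auto. exists v; auto.
    + apply cpt_bunion; intros u. apply cpt_bunion; intros v.
      apply cpt_guard; intros [H _]. apply cpt_arc01, (arc_cont _ _ D); exact H.
Qed.

Definition whole : pt -> Prop := part (fun _ => True) (fun _ _ => True).

Definition same_edge (u v u' v' : nat) : Prop := (u = u' /\ v = v') \/ (u = v' /\ v = u').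

Definition without (u v : nat) : pt -> Prop :=
  part (fun _ => True) (fun u' v' => ~ same_edge u v u' v').

Lemma E_lt u v : E u v -> (u < n)%nat /\ (v < n)%nat.
Proof. apply HG. Qed.

Lemma E_sym u v : E u v -> E v u.
Proof. apply HG. Qed.

Lemma E_neq u v : E u v -> u <> v.
Proof. intros H ->. destruct HG as [_ [I _]]. exact (I v H). Qed.

Lemma pos_whole u : (u < n)%nat -> whole (pos D u).
Proof. intros H; left; exists u; auto. Qed.

Lemma arc_whole u v t : E u v -> 0 <= t <= 1 -> whole (arc D u v t).
Proof. intros H Ht; right; exists u, v; repeat split; auto. exists t; auto. Qed.

Lemma without_interior u v t : E u v -> 0 < t < 1 -> ~ without u v (arc D u v t).
Proof.
  intros He Ht [[w [Hw [_ Ep]]] | [u' [v' [He' [N [s [Hs Ep]]]]]]].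
  - exact (arc_avoid_vertices _ _ D u v w t He Hw Ht Ep).
  - destruct (E_lt _ _ He') as [U' V'].
    destruct (Req_dec s 0) as [-> | S0].
    { rewrite (arc_start _ _ D u' v' He') in Ep. exact (arc_avoid_vertices _ _ D u v u' t He U' Ht Ep). }
    destruct (Req_dec s 1) as [-> | S1].
    { rewrite (arc_end _ _ D u' v' He') in Ep. exact (arc_avoid_vertices _ _ D u v v' t He V' Ht Ep). }
    apply (arc_noncrossing _ _ D u v u' v' t s He He' N Ht); [lra | exact Ep].
Qed.

Lemma whole_split u v : E u v ->
  forall p, whole p <-> without u v p \/ subarc (arc D u v) 0 1 p.
Proof.
  intros He p; split.
  - intros [H | [u' [v' [He' [_ [t [Ht Ep]]]]]]]; [left; left; exact H |].
    destruct (classic (same_edge u v u' v')) as [S | S].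
    + right. destruct S as [[<- <-] | [<- <-]].
      * exists t; auto.
      * exists (1 - t); split; [lra |]. rewrite Ep, <- (arc_sym _ _ D u v t He); reflexivity.
    + left; right. exists u', v'; repeat split; auto. exists t; auto.
  - intros [[H | [u' [v' [He' [_ H]]]]] | [t [Ht ->]]].
    + left; exact H.
    + right; exists u', v'; auto.
    + apply arc_whole; auto.
Qed.

Lemma touches_ext (G G' : pt -> Prop) q w : (forall p, G p <-> G' p) -> touches G q w -> touches G' q w.
Proof.
  intros H T r Hr. destruct (T r Hr) as [u [Hu C]]. exists u; split; [exact Hu |].
  revert C; apply conn_incl; intros p; apply H.
Qed.

(** [touches_arc_start] with the rest of the drawing as [K]. The rest still contains the vertex [v],
    to which the arc is attached. *)
Lemma touches_end u v t q : E u v -> 0 < t < 1 -> ~ whole q ->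
  touches whole q (arc D u v t) -> touches whole q (pos D u).
Proof.
  intros He Ht Hq T. rewrite <- (arc_start _ _ D u v He).
  pose proof (whole_split u v He) as W.
  apply (touches_ext _ _ _ _ (fun p => iff_sym (W p))).
  apply (touches_arc_start (without u v) (arc D u v) q t).
  - apply part_cpt.
  - apply (arc_cont _ _ D), He.
  - apply (arc_inj _ _ D), He.
  - left; exists v. rewrite (arc_end _ _ D u v He). repeat split. apply (E_lt _ _ He).
  - intros s Hs; apply without_interior; auto.
  - exact Ht.
  - intros H; apply Hq, W, H.
  - apply (touches_ext _ _ _ _ W), T.
Qed.

Definition on_edge (u v : nat) (p : pt) : Prop := exists t, 0 < t < 1 /\ p = arc D u v t.

Lemma on_edge_sym u v p : E u v -> on_edge u v p -> on_edge v u p.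
Proof.
  intros He [t [Ht ->]]. exists (1 - t); split; [lra |].
  rewrite (arc_sym _ _ D u v _ He). f_equal; lra.
Qed.

Lemma touches_ends u v p q : E u v -> on_edge u v p -> ~ whole q -> touches whole q p ->
  touches whole q (pos D u) /\ touches whole q (pos D v).
Proof.
  intros He Hp Hq T. split.
  - destruct Hp as [t [Ht ->]]. exact (touches_end u v t q He Ht Hq T).
  - apply (on_edge_sym u v p He) in Hp as [t [Ht ->]].
    exact (touches_end v u t q (E_sym _ _ He) Ht Hq T).
Qed.

Lemma whole_cases p : whole p ->
  (exists u, (u < n)%nat /\ p = pos D u) \/ (exists u v, E u v /\ on_edge u v p).
Proof.
  intros [[w [Hw [_ ->]]] | [u [v [He [_ [t [Ht ->]]]]]]]; [left; eauto |].
  destruct (E_lt _ _ He).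
  destruct (Req_dec t 0) as [-> | T0]; [left; exists u; rewrite (arc_start _ _ D u v He); auto |].
  destruct (Req_dec t 1) as [-> | T1]; [left; exists v; rewrite (arc_end _ _ D u v He); auto |].
  right; exists u, v; split; [exact He |]. exists t; split; [lra | reflexivity].
Qed.

Lemma on_edge_whole u v p : E u v -> on_edge u v p -> whole p.
Proof. intros He [t [Ht ->]]; apply arc_whole; auto; lra. Qed.

Lemma on_edge_not_pos u v w : E u v -> (w < n)%nat -> ~ on_edge u v (pos D w).
Proof. intros He Hw [t [Ht Ep]]. symmetry in Ep. exact (arc_avoid_vertices _ _ D u v w t He Hw Ht Ep). Qed.

Lemma on_edge_unique u v u' v' p : E u v -> E u' v' -> on_edge u v p -> on_edge u' v' p ->
  same_edge u v u' v'.
Proof.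
  intros He He' [t [Ht ->]] [s [Hs Ep]]. apply NNPP; intros N.
  exact (arc_noncrossing _ _ D u v u' v' t s He He' N Ht Hs Ep).
Qed.

Lemma edge_ball u v p : E u v -> on_edge u v p -> exists r, 0 < r /\
  forall q, dinf q p < r -> whole q -> on_edge u v q.
Proof.
  intros He [t [Ht ->]].
  destruct (cpt_closed (without u v) (arc D u v t)) as [r [Hr H]].
  { apply part_cpt. } { apply without_interior; auto. }
  exists r; split; [exact Hr |]. intros q Hq W. specialize (H q Hq).
  apply (whole_split u v He) in W as [W | [s [Hs ->]]]; [tauto |].
  exists s; split; [| reflexivity].
  destruct (E_lt _ _ He) as [Lu Lv].
  assert (s <> 0).
  { intros ->. apply H. rewrite (arc_start _ _ D u v He). left; exists u; auto. }
  assert (s <> 1).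
  { intros ->. apply H. rewrite (arc_end _ _ D u v He). left; exists v; auto. }
  lra.
Qed.

(** On the way from [q] straight to [p] the face first touches the drawing inside the square, hence
    on this edge, and [touches_ends] applies. *)
Lemma edge_ball_touches u v p r q : E u v -> on_edge u v p ->
  (forall q, dinf q p < r -> whole q -> on_edge u v q) -> dinf q p < r -> ~ whole q ->
  touches whole q (pos D u) /\ touches whole q (pos D v).
Proof.
  intros He Hp Hb Hq Wq.
  destruct (first_touch whole q p) as [t [Ht [W T]]]; auto.
  { apply part_cpt. } { apply (on_edge_whole u v); auto. }
  apply (touches_ends u v (seg q p t)); auto. apply Hb; auto.
  apply dinf_seg_ball; auto. rewrite dinf_refl. pose proof (dinf_pos q p). lra.
Qed.

Lemma vertex_ball x : (x < n)%nat -> exists r, 0 < r /\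
  forall q, dinf q (pos D x) < r -> whole q -> q = pos D x \/ exists z, E x z /\ on_edge x z q.
Proof.
  intros Hx.
  destruct (cpt_closed (part (fun w => w <> x) (fun u v => u <> x /\ v <> x)) (pos D x)) as [r [Hr H]].
  { apply part_cpt. }
  { intros [[w [Hw [N Ep]]] | [u [v [He [[N N'] [t [Ht Ep]]]]]]].
    - apply N. symmetry. exact (pos_inj _ _ D x w Hx Hw Ep).
    - destruct (E_lt _ _ He) as [Lu Lv].
      destruct (Req_dec t 0) as [-> | T0].
      { rewrite (arc_start _ _ D u v He) in Ep. apply (pos_inj _ _ D) in Ep; auto. }
      destruct (Req_dec t 1) as [-> | T1].
      { rewrite (arc_end _ _ D u v He) in Ep. apply (pos_inj _ _ D) in Ep; auto. }
      symmetry in Ep. apply (arc_avoid_vertices _ _ D u v x t He Hx) in Ep; auto; lra. }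
  exists r; split; [exact Hr |]. intros q Hq W. specialize (H q Hq).
  destruct (whole_cases q W) as [[u [Hu ->]] | [u [v [He Hp]]]].
  - left. destruct (Nat.eq_dec u x) as [-> | N]; [reflexivity |].
    exfalso; apply H. left; exists u; auto.
  - right. destruct (Nat.eq_dec u x) as [-> | Nu]; [exists v; auto |].
    destruct (Nat.eq_dec v x) as [-> | Nv]; [exists u; split; [apply E_sym | apply on_edge_sym]; auto |].
    exfalso; apply H. right; exists u, v; repeat split; auto.
    destruct Hp as [t [Ht ->]]. exists t; split; [lra | reflexivity].
Qed.

Lemma vertex_ball_touches x r q : (x < n)%nat ->
  (forall q, dinf q (pos D x) < r -> whole q -> q = pos D x \/ exists z, E x z /\ on_edge x z q) ->
  dinf q (pos D x) < r -> ~ whole q -> touches whole q (pos D x).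
Proof.
  intros Hx Hb Hq Wq.
  destruct (first_touch whole q (pos D x)) as [t [Ht [W T]]]; auto.
  { apply part_cpt. } { apply pos_whole; auto. }
  destruct (Hb (seg q (pos D x) t)) as [Ep | [z [He Hp]]]; auto.
  - apply dinf_seg_ball; auto. rewrite dinf_refl. pose proof (dinf_pos q (pos D x)). lra.
  - now rewrite Ep in T.
  - apply (touches_ends x z _ q He Hp Wq T).
Qed.

(** * Connectedness and local connectedness of cofaciality *)

Definition cofacial (u v : nat) : Prop :=
  (u < n)%nat /\ (v < n)%nat /\
  exists q, ~ whole q /\ touches whole q (pos D u) /\ touches whole q (pos D v).

Lemma cofacial_sym u v : cofacial u v -> cofacial v u.
Proof. intros [Hu [Hv [q [H1 [H2 H3]]]]]. split; [auto | split; [auto |]]. exists q; auto. Qed.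

(** An edge does not fill any square around its midpoint, so there is a face close to it, and this
    face touches both ends. *)
Lemma cofacial_edge u v : E u v -> cofacial u v.
Proof.
  intros He. destruct (E_lt _ _ He) as [Lu Lv].
  assert (Hp : on_edge u v (arc D u v (1/2))) by (exists (1/2); split; [lra | reflexivity]).
  destruct (edge_ball u v _ He Hp) as [r [Hr Hb]].
  destruct (arc_no_square (arc D u v) (1/2) r) as [q [Hq Nq]];
    [apply (arc_cont _ _ D), He | apply (arc_inj _ _ D), He | lra | exact Hr |].
  assert (Wq : ~ whole q).
  { intros W. destruct (Hb q Hq W) as [t [Ht ->]]. apply Nq. exists t; split; [lra | reflexivity]. }
  split; [exact Lu | split; [exact Lv |]]. exists q; split; [exact Wq |].
  exact (edge_ball_touches u v _ r q He Hp Hb Hq Wq).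
Qed.

Lemma cofacial_of_touches q u v : ~ whole q -> (u < n)%nat -> (v < n)%nat ->
  touches whole q (pos D u) -> touches whole q (pos D v) -> cofacial u v.
Proof. intros; split; [auto | split; [auto |]]; eauto. Qed.

Definition touches_in (S : nat -> Prop) (q : pt) : Prop :=
  exists s, (s < n)%nat /\ S s /\ touches whole q (pos D s).

Lemma face_ball p : ~ whole p -> exists r, 0 < r /\
  forall u, dinf u p < r -> ~ whole u /\ forall u', dinf u' p < r -> conn whole u u'.
Proof.
  intros Hp. destruct (cpt_closed whole p) as [r [Hr H]]; [apply part_cpt | exact Hp |].
  exists r; split; [exact Hr |]. intros u Hu. split; [auto |].
  intros u' Hu'. apply (conn_ball whole p r); auto.
Qed.

Lemma touches_in_conn S q q' : conn whole q' q -> touches_in S q -> touches_in S q'.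
Proof. intros C [s [Hs [Ss T]]]. exists s; repeat split; auto. exact (touches_conn _ _ _ _ C T). Qed.

(* Colour the plane by [S]: each face by whether it touches a vertex of [S]. If no vertex of [S] is
   cofacial with one outside, this colouring is locally constant. *)
Lemma cofacial_connected (S : nat -> Prop) :
  (exists u, (u < n)%nat /\ S u) -> (exists v, (v < n)%nat /\ ~ S v) ->
  exists u v, (u < n)%nat /\ (v < n)%nat /\ S u /\ ~ S v /\ cofacial u v.
Proof.
  intros [u [Hu Su]] [v [Hv Sv]]. apply NNPP. intros N.
  assert (HS : forall x y, cofacial x y -> S x -> S y).
  { intros x y C Sx. apply NNPP; intros Sy. apply N. exists x, y. destruct C as [Hx [Hy C]].
    split; [auto | split; [auto |]]. split; [auto | split; [auto |]].
    split; [auto | split; auto]. }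
  (* A vertex has its own colour and an edge that of an end; the two ends agree by
     [cofacial_edge]. *)
  set (Q p := (~ whole p /\ touches_in S p) \/ (exists w, (w < n)%nat /\ S w /\ p = pos D w) \/
    (exists x y, E x y /\ S x /\ on_edge x y p)).
  assert (Qface : forall p, ~ whole p -> (Q p <-> touches_in S p)).
  { intros p Hp; split; [| left; auto].
    intros [[_ T] | [[w [Hw [_ ->]]] | [x [y [He [_ Ho]]]]]]; [exact T | |].
    - destruct Hp; apply pos_whole; auto.
    - destruct Hp; apply (on_edge_whole x y); auto. }
  assert (Qpos : forall w, (w < n)%nat -> (Q (pos D w) <-> S w)).
  { intros w Hw; split; [| right; left; exists w; auto].
    intros [[H _] | [[w' [Hw' [Sw Ep]]] | [x [y [He [_ Ho]]]]]].
    - destruct H; apply pos_whole; auto.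
    - now rewrite (pos_inj _ _ D w w' Hw Hw' Ep).
    - destruct (on_edge_not_pos x y w He Hw Ho). }
  assert (Qedge : forall x y p, E x y -> on_edge x y p -> (Q p <-> S x)).
  { intros x y p He Ho; split; [| right; right; exists x, y; auto].
    intros [[H _] | [[w [Hw [_ ->]]] | [x' [y' [He' [Sx Ho']]]]]].
    - destruct H; apply (on_edge_whole x y); auto.
    - destruct (on_edge_not_pos x y w He Hw Ho).
    - destruct (on_edge_unique x y x' y' p) as [[-> ->] | [-> ->]]; auto.
      apply (HS x'); auto. apply cofacial_edge, He'. }
  assert (Qtouch : forall p x, ~ whole p -> (x < n)%nat -> touches whole p (pos D x) -> (Q p <-> S x)).
  { intros p x Hp Hx T. rewrite (Qface p Hp). split.
    - intros [s [Hs [Ss Ts]]]. apply (HS s); auto. exact (cofacial_of_touches p s x Hp Hs Hx Ts T).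
    - intros Sx; exists x; auto. }
  assert (C : conn (fun _ => False) (pos D u) (pos D v)) by (apply conn_seg; intros t _ []).
  assert (QQ : Q (pos D v)); [| apply (Qpos v Hv) in QQ; tauto].
  refine (conn_induction _ Q _ _ _ C (proj2 (Qpos u Hu) Su)).
  intros w _. destruct (classic (whole w)) as [W | W].
  - destruct (whole_cases w W) as [[x [Hx ->]] | [x [y [He Ho]]]].
    + destruct (vertex_ball x Hx) as [r [Hr Hb]]. exists r; split; [exact Hr |].
      assert (K : forall p, dinf p (pos D x) < r -> (Q p <-> S x)).
      { intros p Hp. destruct (classic (whole p)) as [Wp | Wp].
        - destruct (Hb p Hp Wp) as [-> | [z [He Ho]]]; [apply Qpos, Hx | apply (Qedge x z); auto].
        - apply Qtouch; auto. exact (vertex_ball_touches x r p Hx Hb Hp Wp). }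
      intros p p' Hp Hp' _ _ Hq. apply (K p' Hp'), (K p Hp), Hq.
    + destruct (edge_ball x y w He Ho) as [r [Hr Hb]]. exists r; split; [exact Hr |].
      assert (K : forall p, dinf p w < r -> (Q p <-> S x)).
      { intros p Hp. destruct (classic (whole p)) as [Wp | Wp].
        - apply (Qedge x y); auto.
        - apply Qtouch; auto; [apply (E_lt _ _ He) |].
          apply (edge_ball_touches x y w r p He Ho Hb Hp Wp). }
      intros p p' Hp Hp' _ _ Hq. apply (K p' Hp'), (K p Hp), Hq.
  - destruct (face_ball w W) as [r [Hr Hb]]. exists r; split; [exact Hr |].
    intros p p' Hp Hp' _ _ Hq. destruct (Hb p Hp) as [Wp Cp]. destruct (Hb p' Hp') as [Wp' Cp'].
    apply (Qface p' Wp'). apply (Qface p Wp) in Hq. exact (touches_in_conn S p p' (Cp' p Hp) Hq).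
Qed.

(* The same colouring argument on a small punctured square around [x]. *)
Lemma cofacial_locally_connected x (S : nat -> Prop) : (x < n)%nat ->
  (exists y, (y < n)%nat /\ y <> x /\ cofacial x y /\ S y) ->
  (exists z, (z < n)%nat /\ z <> x /\ cofacial x z /\ ~ S z) ->
  exists y z, (y < n)%nat /\ (z < n)%nat /\ y <> x /\ z <> x /\
    cofacial x y /\ cofacial x z /\ S y /\ ~ S z /\ cofacial y z.
Proof.
  intros Hx [y0 [Hy0 [Ny0 [Cy0 Sy0]]]] [z0 [Hz0 [Nz0 [Cz0 Sz0]]]]. apply NNPP. intros N.
  assert (HS : forall y z, y <> x -> z <> x -> cofacial x y -> cofacial x z -> cofacial y z -> S y -> S z).
  { intros y z Ny Nz Cy Cz C Sy. apply NNPP; intros Sz. apply N. exists y, z.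
    pose proof C as [Ly [Lz _]]. tauto. }
  (* Every face near [x] touches [x], so if [x] itself counted it could colour all of them alike. *)
  set (S' y := S y /\ y <> x).
  set (Q p := (~ whole p /\ touches_in S' p) \/ (exists z, E x z /\ S z /\ on_edge x z p)).
  assert (Qface : forall p, ~ whole p -> (Q p <-> touches_in S' p)).
  { intros p Hp; split; [| left; auto].
    intros [[_ T] | [z [He [_ Ho]]]]; [exact T |]. destruct Hp; apply (on_edge_whole x z); auto. }
  assert (Qedge : forall z p, E x z -> on_edge x z p -> (Q p <-> S z)).
  { intros z p He Ho; split; [| right; exists z; auto].
    intros [[H _] | [z' [He' [Sz Ho']]]].
    - destruct H; apply (on_edge_whole x z); auto.
    - destruct (on_edge_unique x z x z' p) as [[_ ->] | [-> _]]; auto.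
      destruct (E_neq _ _ He' eq_refl). }
  assert (Qtouch : forall p z, ~ whole p -> (z < n)%nat -> z <> x ->
    touches whole p (pos D x) -> touches whole p (pos D z) -> (Q p <-> S z)).
  { intros p z Hp Hz Nz Tx Tz. rewrite (Qface p Hp). split.
    - intros [s [Hs [[Ss Ns] Ts]]]. apply (HS s z); auto; eapply cofacial_of_touches; eauto.
    - intros Sz; exists z; repeat split; auto. }
  destruct (vertex_ball x Hx) as [r [Hr Hb]].
  (* The faces that make [y0] and [z0] cofacial with [x] have points [p1] and [p2] in the square
     around [x], with different colours. *)
  destruct Cy0 as [_ [_ [q1 [W1 [T1 T1']]]]]. destruct Cz0 as [_ [_ [q2 [W2 [T2 T2']]]]].
  destruct (T1 r Hr) as [p1 [D1 C1]]. destruct (T2 r Hr) as [p2 [D2 C2]].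
  pose proof (conn_right _ _ _ C1) as Wp1. pose proof (conn_right _ _ _ C2) as Wp2.
  apply conn_sym in C1, C2.
  assert (Q1 : Q p1).
  { apply (Qtouch p1 y0); auto; eapply touches_conn; eauto. }
  assert (Q2 : ~ Q p2).
  { rewrite (Qtouch p2 z0); auto; eapply touches_conn; eauto. }
  apply Q2.
  assert (C : conn (fun u => u = pos D x \/ r <= dinf u (pos D x)) p1 p2).
  { apply conn_punctured_square; auto; intros ->; [apply Wp1 | apply Wp2]; apply pos_whole, Hx. }
  refine (conn_induction _ Q _ _ _ C Q1).
  intros w Hw. assert (Hwr : dinf w (pos D x) < r) by (apply Rnot_le_lt; tauto).
  destruct (classic (whole w)) as [W | W].
  - destruct (Hb w Hwr W) as [Ep | [z [He Ho]]]; [tauto |].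
    destruct (edge_ball x z w He Ho) as [r' [Hr' Hb']]. exists r'; split; [exact Hr' |].
    assert (K : forall p, dinf p w < r' -> (Q p <-> S z)).
    { intros p Hp. destruct (classic (whole p)) as [Wp | Wp].
      - apply Qedge; auto.
      - destruct (edge_ball_touches x z w r' p He Ho Hb' Hp Wp) as [Tx Tz].
        apply Qtouch; auto; [apply (E_lt _ _ He) |]. intros ->. exact (E_neq _ _ He eq_refl). }
    intros p p' Hp Hp' _ _ Hq. apply (K p' Hp'), (K p Hp), Hq.
  - destruct (face_ball w W) as [r' [Hr' Hb']]. exists r'; split; [exact Hr' |].
    intros p p' Hp Hp' _ _ Hq. destruct (Hb' p Hp) as [Wp Cp]. destruct (Hb' p' Hp') as [Wp' Cp'].
    apply (Qface p' Wp'). apply (Qface p Wp) in Hq. exact (touches_in_conn S' p p' (Cp' p Hp) Hq).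
Qed.

Lemma outer_vertex q : (0 < n)%nat -> ~ whole q -> exists a, (a < n)%nat /\ touches whole q (pos D a).
Proof.
  intros Hn Hq. destruct (first_touch whole q (pos D 0)) as [t [Ht [W T]]]; auto.
  { apply part_cpt. } { apply pos_whole; auto. }
  destruct (whole_cases _ W) as [[a [Ha Ep]] | [a [b [He Ho]]]].
  - exists a; split; [exact Ha |]. now rewrite Ep in T.
  - exists a; split; [apply (E_lt _ _ He) |]. exact (proj1 (touches_ends a b _ q He Ho Hq T)).
Qed.

(** * Deletion of vertices and the outer face *)

Lemma on_drawing_part (S : nat -> Prop) p : on_drawing D S p <-> part S (fun u v => S u /\ S v) p.
Proof.
  split; (intros [H | H]; [left; exact H | right]).
  - destruct H as [u [v [t [He [Su [Sv [Ht Ep]]]]]]]. exists u, v; repeat split; auto. exists t; auto.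
  - destruct H as [u [v [He [[Su Sv] [t [Ht Ep]]]]]]. exists u, v, t; auto.
Qed.

Lemma pos_off_drawing (S : nat -> Prop) u : (u < n)%nat -> ~ S u -> ~ on_drawing D S (pos D u).
Proof.
  intros Hu Su [[w [Hw [Sw Ep]]] | [x [y [t [He [Sx [Sy [Ht Ep]]]]]]]].
  - rewrite (pos_inj _ _ D u w Hu Hw Ep) in Su; auto.
  - destruct (E_lt _ _ He) as [Lx Ly].
    destruct (Req_dec t 0) as [-> | T0].
    { rewrite (arc_start _ _ D x y He) in Ep. apply (pos_inj _ _ D) in Ep; auto. congruence. }
    destruct (Req_dec t 1) as [-> | T1].
    { rewrite (arc_end _ _ D x y He) in Ep. apply (pos_inj _ _ D) in Ep; auto. congruence. }
    symmetry in Ep. apply (arc_avoid_vertices _ _ D x y u t He Hu) in Ep; auto; lra.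
Qed.

(** The position of a deleted vertex is off the remaining drawing, so a whole square around it lies
    in a single face. *)
Lemma touches_deleted (S : nat -> Prop) u q : (u < n)%nat -> ~ S u ->
  touches (on_drawing D S) q (pos D u) -> conn (on_drawing D S) q (pos D u).
Proof.
  intros Hu Su T.
  destruct (cpt_closed (on_drawing D S) (pos D u)) as [r [Hr H]].
  { apply (cpt_ext (part S (fun u v => S u /\ S v)));
      [intros p; apply iff_sym, on_drawing_part | apply part_cpt]. }
  { apply pos_off_drawing; auto. }
  destruct (T r Hr) as [p [Hp C]]. apply conn_trans with p; [exact C |].
  apply (conn_ball _ (pos D u) r); auto. rewrite dinf_refl; exact Hr.
Qed.

Lemma touches_on_drawing (S : nat -> Prop) q w : touches whole q w -> touches (on_drawing D S) q w.
Proof.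
  intros T r Hr. destruct (T r Hr) as [u [Hu C]]. exists u; split; [exact Hu |].
  revert C. apply conn_incl. intros p [[x [Hx [_ ->]]] | [x [y [t [He [_ [_ [Ht ->]]]]]]]].
  - apply pos_whole, Hx.
  - apply arc_whole; auto.
Qed.

Lemma touches_through_deleted (S : nat -> Prop) q u v : (u < n)%nat -> ~ S u -> cofacial u v ->
  conn (on_drawing D S) q (pos D u) -> touches (on_drawing D S) q (pos D v).
Proof.
  intros Hu Su [_ [_ [q' [_ [Tu Tv]]]]] C.
  apply touches_conn with q'; [| apply touches_on_drawing, Tv].
  apply conn_trans with (pos D u); [exact C |]. apply conn_sym, touches_deleted; auto.
  apply touches_on_drawing, Tu.
Qed.

Lemma incident_of_touches (S : nat -> Prop) q v :
  (forall p, whole p -> nrm2 p < nrm2 q) -> touches (on_drawing D S) q (pos D v) ->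
  incident_outer D S v.
Proof.
  intros Hq T eps He.
  (* A radius [r] with [r <= 1] and [r <= eps / 2] gives [2 * (r * r) <= eps], the bound of
     [dist2_of_dinf]. *)
  assert (0 < Rmin 1 (eps / 2)) by (apply Rmin_glb_lt; lra).
  destruct (T _ H) as [u [Hu C]]. exists u; split.
  - apply dist2_of_dinf in Hu. pose proof (Rmin_l 1 (eps / 2)). pose proof (Rmin_r 1 (eps / 2)). nra.
  - apply conn_sym in C. destruct (path_of_conn _ _ _ C) as [g [Hg [G0 [G1 Goff]]]].
    exists g; repeat split; auto.
    intros p Hp. rewrite G1. apply Hq.
    destruct Hp as [[x [Hx [_ ->]]] | [x [y [t [Hxy [_ [_ [Ht ->]]]]]]]];
      [apply pos_whole, Hx | apply arc_whole; auto].
Qed.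

Lemma far_point : exists q, forall p, whole p -> nrm2 p < nrm2 q.
Proof.
  destruct (cpt_bounded whole (part_cpt _ _)) as [M [HM B]].
  (* Its squared norm [4 * M^2] exceeds [2 * M^2], a bound for the squared norm on the square of
     radius [M]. *)
  exists (2 * M, 0). intros p Hp. specialize (B p Hp). apply dinf_lt in B; simpl in B.
  unfold nrm2; simpl. nra.
Qed.

(** [linked] is applied to the property of being joined to the far point [q] off the remaining
    drawing; it starts at [a] and spreads over [U]. *)
Lemma deleted_outerplane (U : list nat) a q :
  (forall u, In u U -> (u < n)%nat) -> linked cofacial U ->
  (forall v, (v < n)%nat -> In v U \/ exists u, In u U /\ cofacial v u) ->
  In a U -> touches whole q (pos D a) -> (forall p, whole p -> nrm2 p < nrm2 q) ->
  forall V : nat -> Prop, (forall v, V v -> ~ In v U) -> induced_outerplane D V.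
Proof.
  intros HU L Dom Ha Ta Hq V HV v Hv Vv.
  assert (Ca : conn (on_drawing D V) q (pos D a)).
  { apply touches_deleted; auto; [intros H; exact (HV a H Ha) | apply touches_on_drawing, Ta]. }
  assert (CU : forall u, In u U -> conn (on_drawing D V) q (pos D u)).
  { intros u Hu. refine (L (fun u => conn (on_drawing D V) q (pos D u)) _ a u Ha Hu Ca).
    intros x y Hx Hy C Cx. apply touches_deleted; auto; [intros H; exact (HV y H Hy) |].
    apply (touches_through_deleted V q x y); auto. intros H; exact (HV x H Hx). }
  apply (incident_of_touches V q v Hq).
  destruct (Dom v Hv) as [H | [u [Hu C]]]; [destruct (HV v Vv H) |].
  apply (touches_through_deleted V q u v); auto; [intros H; exact (HV u H Hu) | apply cofacial_sym, C].
Qed.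

End Drawing.

Theorem theorem2 (n : nat) (E : nat -> nat -> Prop) (HG : simple_graph n E)
  (D : drawing n E) :
  exists V' : list nat,
    NoDup V' /\ (forall v, In v V' -> (v < n)%nat) /\
    (n <= 2 * length V')%nat /\
    induced_outerplane D (fun v => In v V').
Proof.
  destruct (far_point n E HG D) as [q Hq].
  assert (Wq : ~ whole n E D q).
  { intros W. specialize (Hq q W). lra. }
  destruct (Nat.eq_dec n 0) as [N0 | N0].
  { exists nil. split; [constructor | split; [intros v [] | split; [simpl; lia |]]]. intros v Hv; lia. }
  destruct (outer_vertex n E HG D q) as [a [Ha Ta]]; [lia | exact Wq |].
  (* A built list has at least two vertices, so a single vertex is treated apart and kept. *)
  destruct (Nat.eq_dec n 1) as [N1 | N1].
  { exists (0%nat :: nil). split; [constructor; [intros [] | constructor] |].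
    split; [intros v [<- | []]; lia | split; [simpl; lia |]].
    intros v Hv _. replace v with a by lia.
    apply (incident_of_touches n E D _ q a Hq), touches_on_drawing, Ta. }
  destruct (built_spanning (cofacial n E D) (cofacial_sym n E D) n) as [l [B Hl]].
  { lia. } { apply cofacial_connected, HG. } { intros x S; apply cofacial_locally_connected, HG. }
  destruct (connected_domination_from (cofacial n E D) (cofacial_sym n E D) l a B)
    as [U [HaU [IU [LU [DU SU]]]]]; [apply Hl, Ha |].
  assert (Ll : length l = n).
  { rewrite <- (length_seq n 0). apply Nat.le_antisymm; apply NoDup_incl_length.
    - exact (built_NoDup _ l B).
    - intros v Hv. apply in_seq. apply Hl in Hv; lia.
    - apply seq_NoDup.
    - intros v Hv. apply Hl. apply in_seq in Hv; lia. }
  set (keep v := if in_dec Nat.eq_dec v U then false else true).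
  assert (Hkeep : forall v, keep v = true <-> ~ In v U).
  { intros v. unfold keep. destruct in_dec; intuition discriminate. }
  exists (filter keep (seq 0 n)). split; [apply NoDup_filter, seq_NoDup |]. split; [| split].
  - intros v Hv. apply filter_In in Hv as [Hv _]. apply in_seq in Hv; lia.
  - pose proof (filter_split keep (seq 0 n)) as LF. rewrite length_seq in LF.
    (* [U] may contain repetitions, so its length is used only as an upper bound for the number of
       deleted vertices. *)
    assert (length (filter (fun v => negb (keep v)) (seq 0 n)) <= length U)%nat; [| lia].
    apply NoDup_incl_length; [apply NoDup_filter, seq_NoDup |].
    intros v Hv. apply filter_In in Hv as [_ Hv].
    unfold keep in Hv. destruct in_dec; [assumption | discriminate].
  - apply (deleted_outerplane n E HG D U a q); auto.
    + intros u Hu. apply Hl, IU, Hu.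
    + intros v Hv. apply DU, Hl, Hv.
    + intros v Hv. apply Hkeep. apply filter_In in Hv; tauto.
Qed.
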